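(* Let $r\ge1$ and let $f,g\in \mathrm{M}_r(\mathbb{C})[Z]$ be such that every eigenvalue of $f(xI)$ and every eigenvalue of $g(xI)$ (in an algebraic closure of $\mathbb{C}(x)$) are multiplicatively independent functions. Then, up to conjugacy, there are at most $$2\left(22\, r^{5} (\deg f+\deg g)(\deg f\cdot \deg g)\right)^r$$ matrices $A\in \mathrm{M}_r(\mathbb{C})$ which commute with all the coefficients of $f$ and of $g$ and such that $(f(A),g(A))$ is a torsion point in $\mathrm{GL}_r(\mathbb{C})^2$; that is, the set of such matrices $A$ is contained in the union of at most that many conjugacy classes of $\mathrm{M}_r(\mathbb{C})$.
   Context: $\mathrm{M}_r(\mathbb{C})$ denotes the $r\times r$ complex matrices, $\mathrm{GL}_r(\mathbb{C})$ the invertible ones, $I$ the identity matrix. A matrix polynomial $f\in\mathrm{M}_r(\mathbb{C})[Z]$ is $f(Z)=C_dZ^d+\cdots+C_0$ with $C_i\in\mathrm{M}_r(\mathbb{C})$ (its coefficients), $C_d\ne0$, $\deg f=d\ge1$; $f(A)=\sum_iC_iA^i$ and $f(xI)=\sum_i C_ix^i$ for a scalar variable $x$. Two matrices $A,B$ are conjugate if $A=VBV^{-1}$ for some invertible $V$. A matrix $A\in\mathrm{GL}_r(\mathbb{C})$ is torsion if $A^n=I$ for some $n\ge1$; a pair $(A,B)$ is a torsion point in $\mathrm{GL}_r(\mathbb{C})^2$ if both $A$ and $B$ are torsion. Two functions $h_1,h_2$ in an algebraic closure of $\mathbb{C}(x)$ are multiplicatively independent if there is no $(k_1,k_2)\in\mathbb{Z}^2\setminus\{(0,0)\}$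 with $h_1^{k_1}h_2^{k_2}=1$. *)

(* Defs.v *)
From HB Require Import structures.
From mathcomp Require Import all_boot all_order all_algebra.
From mathcomp Require Import complex.
From mathcomp Require Import reals.
Set Implicit Arguments. Unset Strict Implicit. Unset Printing Implicit Defensive.
Import Order.TTheory GRing.Theory Num.Theory.
Local Open Scope ring_scope.

Definition mxpoly_eval (F : ringType) (n : nat) (f : {poly 'M[F]_n.+1})
  (A : 'M[F]_n.+1) : 'M[F]_n.+1 :=
  \sum_(i < size f) f`_i * A ^+ i.

Definition mxpoly_xI (F : ringType) (n : nat) (f : {poly 'M[F]_n.+1})
  : 'M[{poly F}]_n.+1 :=
  \matrix_(j, k) \poly_(i < size f) (f`_i j k).

Definition mxdeg (F : ringType) (n : nat) (f : {poly 'M[F]_n.+1}) : nat :=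
  (size f).-1.

Definition mult_indep (K : fieldType) (h1 h2 : K) : Prop :=
  forall k1 k2 : int, h1 ^ k1 * h2 ^ k2 = 1 -> k1 = 0 /\ k2 = 0.

Definition torsion_mx (F : ringType) (n : nat) (A : 'M[F]_n.+1) : Prop :=
  exists m : nat, (0 < m)%N /\ A ^+ m = 1.

Definition mx_conjugate (F : comUnitRingType) (n : nat) (A B : 'M[F]_n.+1) : Prop :=
  exists V : 'M[F]_n.+1, V \in unitmx /\ A = V * B * invmx V.

(* The hypothesis on eigenvalues: inside an algebraically closed field K
   containing F[x] (hence F(x) and an algebraic closure of it), every
   eigenvalue of f(xI) and every eigenvalue of g(xI) are multiplicatively
   independent. *)
Definition eigen_mult_indep (F : fieldType) (n : nat)
  (f g : {poly 'M[F]_n.+1}) : Prop :=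
  exists (K : closedFieldType) (phi : {rmorphism {poly F} -> K}),
    injective phi /\
    forall h1 h2 : K,
      eigenvalue (map_mx phi (mxpoly_xI f)) h1 ->
      eigenvalue (map_mx phi (mxpoly_xI g)) h2 ->
      mult_indep h1 h2.

Definition thm_bound (r df dg : nat) : nat :=
  2 * (22 * r ^ 5 * (df + dg) * (df * dg)) ^ r.

(* Main.v *)
Require Import Defs.
From HB Require Import structures.
From mathcomp Require Import all_boot all_order all_algebra all_field.
From mathcomp Require Import complex polyXY.
From mathcomp Require Import boolp reals.
From mathcomp Require Import zify ring.
Set Implicit Arguments. Unset Strict Implicit. Unset Printing Implicit Defensive.
Import Order.TTheory GRing.Theory Num.Theory.
Local Open Scope ring_scope.

(** If A commutes with the coefficients of f and g and lambda is an eigenvalue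
    of A, then f(A) acts on the lambda-eigenspace of A as f(lambda I), so f(lambda I)
    and g(lambda I) have eigenvalues zeta and xi that are roots of unity. A matrix
    whose spectrum lies in a given set of N points is conjugate to a bidiagonal
    matrix with 0-1 superdiagonal, which leaves N^r 2^(r-1) classes; so it is
    enough to show N <= 72 r^4 (deg f)(deg g) for the number of such lambda.

    A dimension count gives a nonzero F(y,z) of small bidegree that vanishes at
    all pairs (h1,h2) of eigenvalues of f(xI) and g(xI). The ideal of polynomials
    vanishing at one such pair is principal (if h1 is not constant), with a generator G,
    and as h1, h2 are multiplicatively independent, the curve G = 0 is not a
    torsion coset.
    Following Beukers and Smyth, a Galois conjugation of the torsion points on
    this curve, compared with translations by the points of order two modulo the
    stabilizer of the curve, puts them on at most 8 further curves of at most
    twice the bidegree, none containing the first one. If H = 0 is such a curve,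
    the determinant of the operator X |-> sum H_ij f(xI)^i X g(xI)^j is a nonzero
    polynomial in x that vanishes at lambda whenever H(zeta,xi) = 0; its degree
    gives the bound. *)

(** No automorphism of C is constructed. Conjugation rests on the fact that an integer polynomial
    vanishes at all primitive roots of unity of a given order or at none. Nor is an algebraic
    function ever evaluated at a point: what holds for eigenvalues in [K] is carried to a value of x
    by a determinant or a characteristic polynomial over C[x]. The orders of the torsion points have
    no a priori bound, so the count is made on an arbitrary finite set of lambda, with a bound that
    does not involve the orders. Constant eigenvalues of f(xI) are an obstacle, since two constants
    have a vanishing ideal that is not principal. They are split off the characteristic polynomial,
    and by independence they are never roots of unity. The number 8 is 4 + 4: the vectors whose
    double is in the stabilizer form four cosets of it, used once for translates and once for
    conjugates. The curves found for different components are glued into eight polynomials in all,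
    and 72 = 8 * 9 where 9 r^4 (deg f)(deg g) bounds the degree of each determinant. *)

(* In [H : {poly {poly C}}] the inner variable takes the value [a] (eigenvalues of
   f) and the outer variable the value [b] (eigenvalues of g). *)
HB.lock Definition ev (C K : comNzRingType) (iota : {rmorphism C -> K}) (a b : K) :
    {poly {poly C}} -> K :=
  horner_eval b \o map_poly (horner_eval a \o map_poly iota).

Arguments ev {C K} iota a b _.

Notation evp iota h := (ev iota h.1 h.2).
Notation evc u := (@ev _ _ idfun u.1 u.2).

(** * Evaluation of bivariate polynomials *)

Section EvalBivariate.
Variables (C K : comNzRingType) (iota : {rmorphism C -> K}).

Fact ev_zmod_morphism a b : zmod_morphism (ev iota a b).
Proof. by move=> P Q; rewrite ev.unlock rmorphB. Qed.
Fact ev_monoid_morphism a b : monoid_morphism (ev iota a b).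
Proof. by split=> [|P Q]; rewrite ev.unlock ?rmorph1 ?rmorphM. Qed.
HB.instance Definition _ a b :=
  GRing.isZmodMorphism.Build _ _ (ev iota a b) (ev_zmod_morphism a b).
HB.instance Definition _ a b :=
  GRing.isMonoidMorphism.Build _ _ (ev iota a b) (ev_monoid_morphism a b).

Lemma evB a b P Q : ev iota a b (P - Q) = ev iota a b P - ev iota a b Q.
Proof. exact: ev_zmod_morphism. Qed.

Lemma evM a b P Q : ev iota a b (P * Q) = ev iota a b P * ev iota a b Q.
Proof. by have [_ ->] := ev_monoid_morphism a b. Qed.

Lemma evC a b p : ev iota a b p%:P = (map_poly iota p).[a].
Proof. by rewrite ev.unlock /= map_polyC /= /horner_eval hornerC. Qed.

Lemma evCC a b c : ev iota a b c%:P%:P = iota c.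
Proof. by rewrite evC map_polyC /= hornerC. Qed.

Lemma evX a b : ev iota a b 'X = b.
Proof. by rewrite ev.unlock /= map_polyX /horner_eval hornerX. Qed.

Lemma evY a b : ev iota a b 'Y = a.
Proof. by rewrite evC map_polyX hornerX. Qed.

Lemma evE a b (H : {poly {poly C}}) m n : (size H <= n)%N -> (sizeY H <= m)%N ->
  ev iota a b H = \sum_(j < n) \sum_(i < m) iota H`_j`_i * a ^+ i * b ^+ j.
Proof.
move=> sn sm; rewrite ev.unlock /= /horner_eval.
rewrite (@horner_coef_wide _ n); last by rewrite (leq_trans _ sn) ?size_poly.
apply: eq_bigr => j _; rewrite coef_map_id0 /= ?rmorph0 ?horner0 //.
have le : (size (map_poly iota H`_j) <= m)%N.
  apply: leq_trans (size_poly _ _) _.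
  exact: leq_trans (max_size_coefXY _ _) sm.
rewrite /horner_eval (horner_coef_wide _ le) mulr_suml.
by apply: eq_bigr => i _; rewrite coef_map.
Qed.

End EvalBivariate.

(** * Scaling the variables and squaring them *)

HB.lock Definition tr (C : comNzRingType) (s t : C) : {poly {poly C}} -> {poly {poly C}} :=
  comp_poly (t%:P *: 'X) \o map_poly (comp_poly (s *: 'X)).

HB.lock Definition dbl (C : comNzRingType) : {poly {poly C}} -> {poly {poly C}} :=
  comp_poly 'X^2 \o map_poly (comp_poly 'X^2).
Arguments tr {C} s t _.
Arguments dbl {C} _.

Section Translation.
Variable C : fieldType.
Implicit Types (s t : C) (H : {poly {poly C}}).

Fact tr_zmod_morphism s t : zmod_morphism (tr s t).
Proof. by move=> P Q; rewrite tr.unlock rmorphB. Qed.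
Fact tr_monoid_morphism s t : monoid_morphism (tr s t).
Proof. by split=> [|P Q]; rewrite tr.unlock ?rmorph1 ?rmorphM. Qed.
HB.instance Definition _ s t :=
  GRing.isZmodMorphism.Build _ _ (tr s t) (tr_zmod_morphism s t).
HB.instance Definition _ s t :=
  GRing.isMonoidMorphism.Build _ _ (tr s t) (tr_monoid_morphism s t).

Lemma coef_comp_scaleX (R : comNzRingType) (c : R) (p : {poly R}) i :
  (p \Po (c *: 'X))`_i = c ^+ i * p`_i.
Proof.
rewrite comp_polyE coef_sum.
have [lt|ge] := ltnP i (size p).
  rewrite (bigD1 (Ordinal lt)) //= big1 ?addr0 => [|j /negPf nj].
    by rewrite coefZ exprZn coefZ coefXn eqxx mulr1 mulrC.
  by rewrite coefZ exprZn coefZ coefXn eq_sym [_ == _]nj !mulr0.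
rewrite nth_default // mulr0 big1 // => j _.
rewrite coefZ exprZn coefZ coefXn (_ : i == j = false) ?mulr0 //.
by apply/negP => /eqP E; move: (ltn_ord j); rewrite -E ltnNge ge.
Qed.

Lemma coef_tr s t H i j : (tr s t H)`_j`_i = s ^+ i * t ^+ j * H`_j`_i.
Proof.
rewrite tr.unlock /= coef_comp_scaleX coef_map /= -polyC_exp coefCM coef_comp_scaleX.
by rewrite mulrCA mulrA.
Qed.

Lemma trK s t : s != 0 -> t != 0 -> cancel (tr s t) (tr s^-1 t^-1).
Proof.
move=> s0 t0 H; apply/polyP => j; apply/polyP => i; rewrite !coef_tr mulrA.
by rewrite mulrACA -!exprMn !mulVf // !expr1n !mul1r.
Qed.

Lemma trM s t s' t' H : tr s t (tr s' t' H) = tr (s * s') (t * t') H.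
Proof.
apply/polyP => j; apply/polyP => i; rewrite !coef_tr mulrA !exprMn.
by rewrite mulrACA.
Qed.

Lemma tr_eq0 s t H : s != 0 -> t != 0 -> (tr s t H == 0) = (H == 0).
Proof.
move=> s0 t0; apply/eqP/eqP => [E|->]; last exact: rmorph0.
by rewrite -(trK s0 t0 H) E rmorph0.
Qed.

Lemma trX s t : tr s t 'X = t%:P%:P * 'X.
Proof. by rewrite tr.unlock /= map_polyX comp_polyX mul_polyC. Qed.

Lemma trC s t p : tr s t p%:P = (p \Po (s *: 'X))%:P.
Proof. by rewrite tr.unlock /= map_polyC /= comp_polyC. Qed.

Lemma ev_tr (K : comNzRingType) (iota : {rmorphism C -> K}) a b s t H :
  ev iota a b (tr s t H) = ev iota (iota s * a) (iota t * b) H.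
Proof.
elim/poly_ind: H => [|H p IH]; first by rewrite !rmorph0.
rewrite !(rmorphD, rmorphM) /= IH.
rewrite trX trC rmorphM /= !evX evCC !evC; congr (_ + _).
by rewrite map_comp_poly /= map_polyZ /= map_polyX horner_comp !hornerE.
Qed.

Fact dbl_zmod_morphism : zmod_morphism (@dbl C).
Proof. by move=> P Q; rewrite dbl.unlock rmorphB. Qed.
Fact dbl_monoid_morphism : monoid_morphism (@dbl C).
Proof. by split=> [|P Q]; rewrite dbl.unlock ?rmorph1 ?rmorphM. Qed.
HB.instance Definition _ :=
  GRing.isZmodMorphism.Build _ _ (@dbl C) dbl_zmod_morphism.
HB.instance Definition _ :=
  GRing.isMonoidMorphism.Build _ _ (@dbl C) dbl_monoid_morphism.

Lemma dblX : dbl 'X = 'X^2 :> {poly {poly C}}.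
Proof. by rewrite dbl.unlock /= map_polyX comp_polyX. Qed.

Lemma dblC (p : {poly C}) : dbl p%:P = (p \Po 'X^2)%:P.
Proof. by rewrite dbl.unlock /= map_polyC /= comp_polyC. Qed.

Lemma ev_dbl (K : comNzRingType) (iota : {rmorphism C -> K}) a b H :
  ev iota a b (dbl H) = ev iota (a ^+ 2) (b ^+ 2) H.
Proof.
elim/poly_ind: H => [|H p IH]; first by rewrite !rmorph0.
rewrite !(rmorphD, rmorphM) /= IH dblX dblC rmorphXn /= !evX !evC.
by rewrite map_comp_poly /= map_polyXn horner_comp hornerXn.
Qed.

Lemma coef_dbl H i j : (dbl H)`_j`_i =
  if (2 %| j)%N && (2 %| i)%N then H`_(j %/ 2)`_(i %/ 2) else 0.
Proof.
rewrite dbl.unlock /= coef_comp_poly_Xn //; case: ifP => _; last by rewrite coef0.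
by rewrite coef_map /= coef_comp_poly_Xn.
Qed.

Lemma tr_dbl s t H : tr s t (dbl H) = dbl (tr (s ^+ 2) (t ^+ 2) H).
Proof.
apply/polyP => j; apply/polyP => i; rewrite coef_tr !coef_dbl coef_tr.
case: ifP => [/andP[dj di]|]; last by rewrite mulr0.
by rewrite -!exprM !(mulnC 2) !divnK.
Qed.

Lemma tr_size s t H : s != 0 -> t != 0 -> size (tr s t H) = size H.
Proof.
move=> s0 t0.
have le u v H' : (size (tr u v H') <= size H')%N.
  apply/leq_sizeP => j hj; apply/polyP => i.
  by rewrite coef_tr (nth_default 0 hj) coef0 mulr0.
by apply/eqP; rewrite eqn_leq le -{1}(trK s0 t0 H) le.
Qed.

Lemma tr_sizeY s t H : s != 0 -> t != 0 -> sizeY (tr s t H) = sizeY H.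
Proof.
move=> s0 t0.
have le u v H' : (sizeY (tr u v H') <= sizeY H')%N.
  rewrite !sizeYE; apply/leq_sizeP => j hj; apply/polyP => i.
  by rewrite coef_swapXY coef_tr -coef_swapXY (nth_default 0 hj) coef0 mulr0.
by apply/eqP; rewrite eqn_leq le -{1}(trK s0 t0 H) le.
Qed.

Lemma size_dbl H : ((size (dbl H)).-1 <= (size H).-1.*2)%N.
Proof.
have le : (size (map_poly (comp_poly 'X^2) H) <= size H)%N by exact: size_poly.
rewrite dbl.unlock /= size_comp_poly size_polyXn muln2 leq_double.
by case: (size _) le => [|u] //=; case: (size H).
Qed.

Lemma sizeY_dbl H : ((sizeY (dbl H)).-1 <= (sizeY H).-1.*2)%N.
Proof.
rewrite !sizeYE (_ : swapXY (dbl H) = dbl (swapXY H)) ?size_dbl //.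
apply/polyP => j; apply/polyP => i.
by rewrite coef_swapXY !coef_dbl andbC coef_swapXY.
Qed.

End Translation.

(** * Bidegrees *)

Section BivariateSizes.
Variable C : idomainType.
Implicit Types P Q : {poly {poly C}}.

Lemma sizeYM P Q : P != 0 -> Q != 0 -> sizeY (P * Q) = (sizeY P + sizeY Q).-1.
Proof. by move=> P0 Q0; rewrite !sizeYE rmorphM /= size_mul // swapXY_eq0. Qed.

Lemma sizeY_gt0 P : (0 < sizeY P)%N = (P != 0).
Proof. by rewrite lt0n sizeY_eq0. Qed.

Lemma biv_const P : (size P <= 1)%N -> (sizeY P <= 1)%N -> P = (P`_0`_0)%:P%:P.
Proof.
move=> sP sY; rewrite {1}[P]size1_polyC //; congr _%:P.
by apply: size1_polyC; apply: leq_trans (max_size_coefXY _ _) sY.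
Qed.

Lemma sizeY_le P n :
  (forall i j, P`_j`_i != 0 -> (i < n)%N) -> (sizeY P <= n)%N.
Proof.
move=> h; rewrite sizeYE; apply/leq_sizeP => i le; apply/polyP => j.
rewrite coef_swapXY coef0; apply/eqP; apply: contraLR le => /h.
by rewrite -ltnNge.
Qed.

Lemma size_le_supp P n :
  (forall i j, P`_j`_i != 0 -> (j < n)%N) -> (size P <= n)%N.
Proof.
move=> h; apply/leq_sizeP => j le; apply/polyP => i.
rewrite coef0; apply/eqP; apply: contraLR le => /h.
by rewrite -ltnNge.
Qed.

End BivariateSizes.

Lemma ex_least (P : nat -> Prop) : (exists n, P n) ->
  exists2 n, P n & forall m, P m -> (n <= m)%N.
Proof.
move=> exP; have exB : exists n, `[< P n >] by case: exP => n /asboolP; exists n.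
case: (ex_minnP exB) => n /asboolP Pn h; exists n => // m /asboolP; exact: h.
Qed.

(** * Polynomial relations between two functions *)

Section Generators.
Variables (C : numClosedFieldType) (K : fieldType) (iota : {rmorphism C -> K}).
Implicit Types (h k : K * K) (F G H Q : {poly {poly C}}).

Local Notation evp h := (evp iota h).

Definition nonconst (x : K) := forall c, iota c != x.

Definition isgen h G :=
  [/\ G != 0, evp h G = 0 &
      forall H, evp h H = 0 -> exists Q, H = Q * G].

Lemma alg_const (p : {poly C}) (w : K) :
  p != 0 -> root (map_poly iota p) w -> exists c, w = iota c.
Proof.
move=> p0; have [rs Ep] := closed_field_poly_normal p.
have -> : map_poly iota p =
    iota (lead_coef p) *: \prod_(z <- map iota rs) ('X - z%:P).
  rewrite {1}Ep map_polyZ rmorph_prod big_map; congr (_ *: _).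
  by apply: eq_bigr => z _; rewrite /= rmorphB /= map_polyX map_polyC.
rewrite rootZ ?fmorph_eq0 ?lead_coef_eq0 // root_prod_XsubC.
by case/mapP => c _ ->; exists c.
Qed.

Lemma evpC h p : evp h p%:P = (map_poly iota p).[h.1].
Proof. exact: evC. Qed.

Lemma evpC_neq0 h p : nonconst h.1 -> p != 0 -> evp h p%:P != 0.
Proof.
move=> nc p0; rewrite evpC; apply/negP => /(alg_const p0) [c E].
by case/eqP: (nc c).
Qed.

Lemma factor_root_coef (c : C) P : map_poly (horner_eval c) P = 0 ->
  exists P', P = ('X - c%:P)%:P * P'.
Proof.
move=> E; exists (map_poly (fun p => p %/ ('X - c%:P)) P).
apply/polyP => j; rewrite coefCM coef_map_id0 ?div0p // mulrC divpK //.
rewrite dvdp_XsubCl; move/(congr1 (fun p : {poly C} => p`_j)): E.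
by rewrite coef0 coef_map => /eqP.
Qed.

(** Minimality is lexicographic: the outer degree, then the degree of the leading coefficient. By
    the first, pseudo-division by [G] leaves no remainder. The second plays the role of Gauss's
    lemma: a factor of [G] in the inner variable alone does not vanish at the nonconstant [h.1] and
    could be divided out, so the linear factors of the multiplier [d] all divide the quotient. *)
Lemma gen_exists h F : nonconst h.1 -> F != 0 -> evp h F = 0 ->
  exists G, isgen h G.
Proof.
move=> nc F0 hF.
have [|n [G1 [G10 hG1 sG1]] minn] := @ex_least
  (fun n => exists G, [/\ G != 0, evp h G = 0 & size G = n]).
  by exists (size F), F.
have [|l [G [G0 hG sG lG]] minl] := @ex_least
  (fun l => exists G, [/\ G != 0, evp h G = 0, size G = n & size (lead_coef G) = l]).
  by exists (size (lead_coef G1)), G1.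
exists G; split=> // H hH.
have cancelG : forall m (d : {poly C}) H' Q, (size d <= m)%N -> d != 0 ->
    d%:P * H' = Q * G -> exists Q', H' = Q' * G.
  elim=> [|m IH] d H' Q; first by rewrite leqn0 size_poly_eq0 => ->.
  move=> sd d0 E; have [/eqP s1|s1] := boolP (size d == 1).
    have /eqP Ed := s1; move/size_poly1P: Ed => [c c0 Ed].
    exists ((c^-1)%:P%:P * Q); rewrite -mulrA -E Ed mulrA -!polyCM mulVf //.
    by rewrite mul1r.
  have [c /factor_theorem [d' Ed]] := closed_rootP _ s1.
  have d'0 : d' != 0 by apply: contraNneq d0 => d'0; rewrite Ed d'0 mul0r.
  have : map_poly (horner_eval c) Q * map_poly (horner_eval c) G = 0.
    rewrite -rmorphM -E rmorphM /= map_polyC /= /horner_eval Ed hornerM.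
    by rewrite hornerXsubC subrr mulr0 mul0r.
  move/eqP; rewrite mulf_eq0 => /orP[] /eqP /factor_root_coef.
    case=> Q' EQ; apply: (IH d' H' Q') => //.
      by move: sd; rewrite Ed size_Mmonic ?monicXsubC // size_XsubC addn2.
    apply: (@mulfI _ (('X - c%:P)%:P)); first by rewrite polyC_eq0 polyXsubC_eq0.
    by rewrite !mulrA -EQ -E Ed -polyCM (mulrC d').
  case=> G' EG; have G'0 : G' != 0.
    by apply: contraNneq G0 => G'0; rewrite EG G'0 mulr0.
  have X0 : ('X - c%:P : {poly C}) != 0 by rewrite polyXsubC_eq0.
  have : (l <= size (lead_coef G'))%N.
    apply: minl; exists G'; split=> //; last first.
      by rewrite -sG EG size_Cmul.
    move/eqP: hG; rewrite EG rmorphM mulf_eq0 (negPf (evpC_neq0 nc X0)) /=.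
    by move/eqP.
  rewrite -lG EG lead_coefM lead_coefC size_monicM ?monicXsubC ?lead_coef_eq0 //.
  by rewrite size_XsubC /= ltnn.
have := Pdiv.Idomain.divp_eq H G; set d := lead_coef G ^+ _ => E.
have d0 : d != 0 by rewrite expf_neq0 // lead_coef_eq0.
have R0 : Pdiv.Idomain.modp H G = 0.
  apply/eqP; apply: contraT => R0.
  have : (n <= size (H %% G)%R)%N.
    apply: minn; exists (H %% G); split=> //.
    move/(congr1 (evp h)): E; rewrite rmorphD rmorphM /= hG mulr0 add0r -mul_polyC.
    by rewrite rmorphM /= hH mulr0.
  by rewrite -sG leqNgt ltn_modp G0.
rewrite R0 addr0 -mul_polyC in E.
exact: cancelG E.
Qed.

(** The generator at [h] is irreducible: it is a multiple of the generator at [k], and if the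
    cofactor vanished at [h], the generator at [k] would be a unit. So the generator at [k] vanishes
    at [h]. *)
Lemma gen_transfer h k G : nonconst k.1 -> isgen h G -> evp k G = 0 ->
  forall H, evp k H = 0 -> evp h H = 0.
Proof.
move=> nc [G0 hG Gdvd] kG; have [Gk [Gk0 kGk Gkdvd]] := gen_exists nc G0 kG.
move=> H kH; have [Q EG] := Gkdvd _ kG; have [Q' ->] := Gkdvd _ kH.
have /eqP := hG; rewrite {1}EG rmorphM mulf_eq0 => /orP[] /eqP E; last first.
  by rewrite rmorphM /= E mulr0.
have [Q1 EQ] := Gdvd _ E; have : Gk * G * Q1 = 1 * G.
  by rewrite mul1r [RHS]EG EQ; ring.
rewrite mulrAC => /(mulIf G0) /(congr1 (evp k)); rewrite rmorphM rmorph1 /=.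
by rewrite kGk mul0r => /esym/eqP; rewrite oner_eq0.
Qed.

Lemma gen_small h G H : isgen h G -> H != 0 -> evp h H = 0 ->
  (size H <= size G)%N -> (sizeY H <= sizeY G)%N ->
  exists2 c, c != 0 & H = c%:P%:P * G.
Proof.
move=> [G0 hG Gdvd] H0 /Gdvd [Q EH]; have Q0 : Q != 0.
  by apply: contraNneq H0 => Q0; rewrite EH Q0 mul0r.
have := Q0; have := G0; rewrite -!size_poly_gt0 => sG sQ.
have := Q0; have := G0; rewrite -!sizeY_gt0 => yG yQ.
rewrite {1 2}EH size_mul // sizeYM // => s1 s2.
have aux a b : (0 < b -> (a + b).-1 <= b -> a <= 1)%N by lia.
have EQ : Q = (Q`_0`_0)%:P%:P.
  by apply: biv_const; [apply: aux s1 | apply: aux s2].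
exists (Q`_0`_0); last by rewrite EH {1}EQ.
by apply: contraNneq Q0 => c0; rewrite EQ c0 !polyC0.
Qed.

(** At the first point none of the later generators vanishes, so the cofactor they leave must vanish
    there; this is why the condition is one-sided. *)
Lemma gens_dvd (L : seq ((K * K) * {poly {poly C}})) F :
  (forall x, x \in L -> isgen x.1 x.2) ->
  pairwise (fun x y => evp x.1 y.2 != 0) L ->
  (forall x, x \in L -> evp x.1 F = 0) ->
  exists Q, F = Q * \prod_(x <- L) x.2.
Proof.
elim: L => [|x L IH] gL pw hF; first by exists F; rewrite big_nil mulr1.
move: pw => /= /andP[/allP px pw].
have [||Q EF] := IH _ pw.
- by move=> y yL; apply: gL; rewrite inE yL orbT.
- by move=> y yL; apply: hF; rewrite inE yL orbT.
have [_ _ dv] := gL x (mem_head _ _).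
have : evp x.1 Q = 0.
  apply/eqP; have /eqP := hF x (mem_head _ _).
  rewrite EF rmorphM mulf_eq0 rmorph_prod => /orP[] // .
  rewrite big_seq_cond prodf_seq_eq0 => /hasP[y yL]; rewrite andbT => /andP[_ /eqP E].
  by move: (px y yL); rewrite E eqxx.
move/dv => [Q' EQ]; exists Q'.
by rewrite big_cons EF EQ mulrA.
Qed.

End Generators.

(** * Galois conjugation of torsion points *)

Section GaloisConjugation.
Variable C : numClosedFieldType.
Local Notation ZtoC := (intr : int -> C).
Local Notation pZtoC := (map_poly ZtoC).

(** As X^m - 1 is the product of the Phi_d for d dividing m, [w] is a root of some Phi_d; then w^d =
    1, and the order m of [w] divides d. *)
Lemma root_Cyclotomic m (w : C) : m.-primitive_root w -> root (pZtoC 'Phi_m) w.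
Proof.
move=> pw; have m0 := prim_order_gt0 pw.
have : root (pZtoC ('X^m - 1)) w.
  by rewrite rmorphB /= rmorph1 map_polyXn /root !hornerE (prim_expr_order pw) subrr.
rewrite -prod_Cyclotomic // rmorph_prod /= /root horner_prod.
rewrite prodf_seq_eq0 => /hasP[d]; rewrite -dvdn_divisors // => dm /= rd.
have d0 : (0 < d)%N := dvdn_gt0 m0 dm.
suff dvd : (m %| d)%N.
  by have <- : d = m by apply/eqP; rewrite eqn_dvd dm dvd.
rewrite (prim_order_dvd pw).
have : root (pZtoC ('X^d - 1)) w.
  rewrite -prod_Cyclotomic // (big_rem d) -?dvdn_divisors //= rmorphM rootM.
  by rewrite /root rd.
by rewrite rmorphB /= rmorph1 map_polyXn /root !hornerE subr_eq0.
Qed.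

(** Irreducibility over the rationals is read off in [algC]: a nontrivial gcd has a root there,
    which is a primitive root of unity with minimal polynomial Phi_m. *)
Lemma Cyclotomic_irreducible m (q : {poly rat}) : (0 < m)%N ->
  coprimep (map_poly intr 'Phi_m) q \/ map_poly intr 'Phi_m %| q.
Proof.
move=> m0; have [z0 pz0] := C_prim_root_exists m0.
have mapQ : map_poly (ratr : rat -> algC) (map_poly intr 'Phi_m) = map_poly intr 'Phi_m.
  by rewrite -map_poly_comp; apply: eq_map_poly => b; rewrite /= rmorph_int.
have dv (z : algC) : m.-primitive_root z ->
    root (map_poly ratr q) z = (map_poly intr 'Phi_m %| q).
  move=> pz; have [pf [Dpf _] ->] := minCpolyP z; congr (_ %| _).
  apply: (map_inj_poly (fmorph_inj (@ratr algC))); first exact: rmorph0.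
  by rewrite -Dpf (minCpoly_cyclotomic pz) mapQ (Cintr_Cyclotomic pz).
case: (boolP (coprimep (map_poly intr 'Phi_m) q)); [by left|move=> nco; right].
have nz : map_poly intr 'Phi_m != 0 :> {poly rat}.
  by rewrite map_poly_eq0_id0 ?monic_neq0 ?Cyclotomic_monic // (monicP (Cyclotomic_monic m)).
have /closed_rootP [z] : size (map_poly (@ratr algC)
    (gcdp (map_poly intr 'Phi_m) q)) != 1%N.
  by rewrite size_map_poly -/(coprimep _ _).
rewrite gcdp_map root_gcd mapQ => /andP[].
by rewrite (Cintr_Cyclotomic pz0) root_cyclotomic // => pz; rewrite dv.
Qed.

(** This replaces a Galois automorphism sending [w] to [w ^+ k]: a polynomial over the rationals
    that vanishes at [w] is a multiple of Phi_m, which also vanishes at [w ^+ k]. *)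
Lemma int_root_conj m (w : C) k (p : {poly int}) :
  m.-primitive_root w -> coprime k m ->
  root (pZtoC p) w -> root (pZtoC p) (w ^+ k).
Proof.
move=> pw co rw; have m0 := prim_order_gt0 pw.
have mapQ (q : {poly int}) : map_poly (ratr : rat -> C) (map_poly intr q) = pZtoC q.
  by rewrite -map_poly_comp; apply: eq_map_poly => b; rewrite /= rmorph_int.
have pwk : m.-primitive_root (w ^+ k) by rewrite prim_root_exp_coprime.
have [cop|/dvdpP[q Eq]] := Cyclotomic_irreducible (map_poly intr p) m0.
  have : coprimep (map_poly (@ratr C) (map_poly intr 'Phi_m))
     (map_poly (@ratr C) (map_poly intr p)) by rewrite coprimep_map.
  rewrite !mapQ => /coprimep_root /(_ (root_Cyclotomic pw)).
  by rewrite -/(root _ _) rw.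
by rewrite -mapQ Eq rmorphM /= mapQ rootM (root_Cyclotomic pwk) orbT.
Qed.

Lemma int_root_conjE m (w : C) k (p : {poly int}) :
  m.-primitive_root w -> coprime k m ->
  root (pZtoC p) (w ^+ k) = root (pZtoC p) w.
Proof.
move=> pw co; apply/idP/idP; last exact: int_root_conj pw co.
have pwk : m.-primitive_root (w ^+ k) by rewrite prim_root_exp_coprime.
have [k0|k0] := posnP k.
  move: co pw; rewrite k0 /coprime gcd0n => /eqP -> /prim_expr_order.
  by rewrite expr1 => ->; rewrite expr0.
have [a b Eab _] := egcdnP m k0; rewrite mulnC (eqP co) in Eab.
have wka : w ^+ k ^+ a = w.
  by rewrite -exprM Eab addn1 exprS mulnC exprM (prim_expr_order pw) expr1n mulr1.
move=> rk; rewrite -wka; apply: int_root_conj pwk _ rk.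
have : coprime m (k * a) by rewrite Eab /coprime gcdnMDl gcdn1.
by rewrite coprimeMr => /andP[_]; rewrite coprime_sym.
Qed.

Definition int_mx_at p q (w : C) (A : 'M[{poly int}]_(p, q)) : 'M[C]_(p, q) :=
  map_mx (fun r : {poly int} => (pZtoC r).[w]) A.

(** A maximal minor that is nonzero at [w ^+ k] is the value of an integer polynomial, hence it is
    nonzero at [w] too. *)
Lemma rank_conj p q m (w : C) k (A : 'M[{poly int}]_(p, q)) :
  m.-primitive_root w -> coprime k m ->
  row_full (int_mx_at (w ^+ k) A) -> row_full (int_mx_at w A).
Proof.
move=> pw co rf; have := fullrowsub_unit rf; set phi := fullrankfun rf.
have det_at z : \det (rowsub phi (int_mx_at z A)) = (pZtoC (\det (rowsub phi A))).[z].
  rewrite -[RHS]/((horner_eval z \o map_poly intr) _) -det_map_mx.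
  by congr (\det _); apply/matrixP => i j; rewrite !mxE.
rewrite unitmxE unitfE det_at -/(root _ _) (int_root_conjE _ pw co) /root -det_at.
rewrite -unitfE -unitmxE -row_full_unit -!sub1mx => le.
exact: submx_trans le (rowsub_sub _ _).
Qed.

(* The polynomials with support in that of [G] that vanish at the given points form
   the kernel of a matrix with entries in Z[w], and Galois conjugation preserves
   its rank; so [G'] has coefficients unrelated to those of [G]. *)
Lemma conj_poly m (w : C) k (L : seq (nat * nat)) (G : {poly {poly C}}) :
  m.-primitive_root w -> coprime k m -> G != 0 ->
  (forall u, u \in L -> @ev C C idfun (w ^+ u.1) (w ^+ u.2) G = 0) ->
  exists G' : {poly {poly C}}, [/\ G' != 0,
    forall i j, G'`_j`_i != 0 -> G`_j`_i != 0 &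
    forall u, u \in L -> @ev C C idfun (w ^+ (k * u.1)) (w ^+ (k * u.2)) G' = 0].
Proof.
move=> pw co G0 GL; pose n := size G; pose r := sizeY G.
pose T : finType := ('I_n * 'I_r)%type.
pose eT (b : 'I_#|T|) : T := enum_val b; pose eL a := nth (0, 0)%N L a.
pose A1 : 'M[{poly int}]_(size L, #|T|) := \matrix_(a, b)
  'X^((eL a).1 * (eT b).2 + (eL a).2 * (eT b).1)%N.
(* These rows force a kernel vector to vanish outside the support of [G]. *)
pose A2 : 'M[{poly int}]_(#|T|, #|T|) := \matrix_(a, b)
  ((a == b) && (G`_(eT b).1`_(eT b).2 == 0))%:R.
pose A := col_mx A1 A2.
pose cP (c : 'cV[C]_#|T|) : {poly {poly C}} := \poly_(j < n) \poly_(i < r)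
  (if (insub j, insub i) is (Some j', Some i') then c (enum_rank ((j', i') : T)) 0 else 0).
have cPE c b : (cP c)`_(eT b).1`_(eT b).2 = c b 0.
  rewrite !coef_poly !ltn_ord !valK /= -[in RHS](enum_valK b) -/(eT b).
  by rewrite coef_poly ltn_ord valK; case: (eT b).
have cPsupp c i j : (cP c)`_j`_i != 0 ->
    exists2 b, ((j = (eT b).1 :> nat) * (i = (eT b).2 :> nat))%type & c b 0 != 0.
  have [jn|jn] := ltnP j n; last by rewrite coef_poly ltnNge jn coef0 eqxx.
  have [ir|ir] := ltnP i r; last by rewrite !coef_poly jn coef_poly ltnNge ir eqxx.
  have := cPE c (enum_rank ((Ordinal jn, Ordinal ir) : T)).
  rewrite /eT enum_rankK /= => -> c0; exists (enum_rank ((Ordinal jn, Ordinal ir) : T)) => //.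
  by rewrite /eT enum_rankK.
have atA2c z (c : 'cV[C]_#|T|) a : (int_mx_at z A2 *m c) a 0 =
    (G`_(eT a).1`_(eT a).2 == 0)%:R * c a 0.
  rewrite !mxE (bigD1 a) //= !mxE eqxx big1 ?addr0 => [|b nb].
    by case: (_ == _); rewrite ?rmorph1 ?rmorph0 ?hornerC ?horner0.
  by rewrite !mxE eq_sym (negPf nb) rmorph0 horner0 mul0r.
have atA1c z c (a : 'I_(size L)) : (int_mx_at z A1 *m c) a 0 =
    @ev C C idfun (z ^+ (eL a).1) (z ^+ (eL a).2) (cP c).
  rewrite (@evE _ _ _ _ _ _ r n) ?size_poly //; last first.
    apply/sizeY_le => i j /cPsupp [b [_ ->] _]; exact: ltn_ord.
  rewrite pair_big mxE (reindex eT) /=; last exact/onW_bij/enum_val_bij.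
  apply: eq_bigr => b _; rewrite cPE !mxE map_polyXn hornerXn -!exprM -mulrA -exprD.
  by rewrite mulrC.
have atAc z c : int_mx_at z A *m c = 0 <->
    (forall u, u \in L -> @ev C C idfun (z ^+ u.1) (z ^+ u.2) (cP c) = 0) /\
    (forall i j, (cP c)`_j`_i != 0 -> G`_j`_i != 0).
  have -> : int_mx_at z A = col_mx (int_mx_at z A1) (int_mx_at z A2).
    exact: map_col_mx.
  rewrite mul_col_mx; split.
    move/eqP; rewrite col_mx_eq0 => /andP[/eqP E1 /eqP E2]; split.
      move=> u uL; have lt : (index u L < size L)%N by rewrite index_mem.
      have := atA1c z c (Ordinal lt).
      by rewrite E1 mxE /eL /= nth_index // => <-.
    move=> i j /cPsupp [b [-> ->] cb]; have := atA2c z c b; rewrite E2 mxE.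
    by case: eqP => // _ /esym/eqP; rewrite mul1r (negPf cb).
  case=> h1 h2; apply/eqP; rewrite col_mx_eq0; apply/andP; split; apply/eqP/matrixP => a o.
    by rewrite ord1 atA1c mxE h1 // mem_nth.
  rewrite ord1 atA2c mxE; case: eqP => E; last by rewrite mul0r.
  have [->|c0] := eqVneq (c a 0) 0; first by rewrite mulr0.
  by have := h2 (eT a).2 (eT a).1; rewrite cPE E eqxx => /(_ c0).
have fullP z : row_full (int_mx_at z A) <-> (forall c : 'cV_#|T|, int_mx_at z A *m c = 0 -> c = 0).
  split=> [/row_fullP[B EB] c E|h].
    by rewrite -[c]mul1mx -EB -mulmxA E mulmx0.
  rewrite -cokermx_eq0; apply/eqP/matrixP => a b.
  have /(congr1 (fun c : 'cV__ => c a 0)) : col b (cokermx (int_mx_at z A)) = 0.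
    by apply: h; rewrite colE mulmxA mulmx_coker mul0mx.
  by rewrite !mxE.
have GcP : G = cP (\col_b G`_(eT b).1`_(eT b).2).
  apply/polyP => j; apply/polyP => i.
  have [jn|jn] := ltnP j n; last by rewrite (nth_default 0 jn) coef_poly ltnNge jn.
  have [ir|ir] := ltnP i r; last first.
    rewrite !coef_poly jn coef_poly ltnNge ir /= nth_default //.
    exact: leq_trans (max_size_coefXY _ _) ir.
  have := cPE (\col_b G`_(eT b).1`_(eT b).2) (enum_rank ((Ordinal jn, Ordinal ir) : T)).
  by rewrite mxE /eT enum_rankK /= => ->.
have nf : ~ row_full (int_mx_at (w ^+ k) A).
  move/(rank_conj pw co)/fullP => h.
  have Z : \col_b G`_(eT b).1`_(eT b).2 = 0 :> 'cV_#|T|.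
    by apply: h; apply/atAc; rewrite -GcP.
  case/eqP: G0; rewrite GcP Z.
  apply/polyP => j; apply/polyP => i; rewrite !coef0; apply/eqP.
  by apply: contraT => /cPsupp[b _]; rewrite mxE eqxx.
have [c [Ac c0]] : exists c : 'cV_#|T|, int_mx_at (w ^+ k) A *m c = 0 /\ c != 0.
  apply: contrapT => ne; apply/nf/fullP => c Ac; apply/eqP.
  by apply: contraT => c0; case: ne; exists c.
have [h1 h2] := (atAc _ _).1 Ac; exists (cP c); split=> //.
  apply: contraNneq c0 => E; apply/eqP/matrixP => b o.
  by rewrite ord1 -cPE E !coef0 mxE.
by move=> u /h1; rewrite -!exprM.
Qed.
End GaloisConjugation.

(** * The support of a curve with a torsion point *)

(** Twice the signed area of the triangle, nonzero exactly when the three exponents are not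
    collinear. *)
Definition cross (s0 s1 s2 : nat * nat) : int :=
  (s1.1%:Z - s0.1%:Z) * (s2.2%:Z - s0.2%:Z) - (s1.2%:Z - s0.2%:Z) * (s2.1%:Z - s0.1%:Z).

Definition insupp (C : nzRingType) (G : {poly {poly C}}) (s : nat * nat) :=
  G`_s.2`_s.1 != 0.

Lemma evp_pairs (C : numClosedFieldType) (K : fieldType) (iota : {rmorphism C -> K})
    (h : K * K) (G : {poly {poly C}}) : evp iota h G =
  \sum_(x : 'I_(size G) * 'I_(sizeY G)) iota G`_x.1`_x.2 * h.1 ^+ x.2 * h.2 ^+ x.1.
Proof. by rewrite (evE _ _ _ (leqnn _) (leqnn _)) pair_big. Qed.

Section SupportNoncollinear.
Variables (C : numClosedFieldType) (K : fieldType) (iota : {rmorphism C -> K}).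

(* If the support lies on a line, G(h) = 0 is a polynomial relation for a single
   monomial h.1^p0 h.2^q0, which is therefore constant; a torsion point on the
   curve makes the constant a root of unity. *)
Lemma supp_noncollinear (h : K * K) G (u : C * C) n :
  nonconst iota h.1 -> mult_indep h.1 h.2 -> isgen iota h G ->
  (0 < n)%N -> u.1 ^+ n = 1 -> u.2 ^+ n = 1 -> evc u G = 0 ->
  exists s : (nat * nat) * (nat * nat) * (nat * nat),
    [/\ insupp G s.1.1, insupp G s.1.2, insupp G s.2 & cross s.1.1 s.1.2 s.2 != 0].
Proof.
move=> nc mi [G0 hG Gdvd] n0 u1n u2n uG; apply: contrapT => nex.
have coll s0 s1 s2 : insupp G s0 -> insupp G s1 -> insupp G s2 -> cross s0 s1 s2 = 0.
  by move=> i0 i1 i2; apply: contrapT => /eqP ne; apply: nex; exists (s0, s1, s2).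
have rt0 (x : C) : x ^+ n = 1 -> x != 0.
  by move=> E; apply: contraTneq (oner_neq0 C) => x0; rewrite -E x0 expr0n gtn_eqF ?eqxx.
have u10 := rt0 _ u1n; have u20 := rt0 _ u2n.
have h10 : h.1 != 0 by rewrite -(rmorph0 iota) eq_sym; apply: nc.
have h20 : h.2 != 0.
  apply/eqP => E; have /Gdvd [Q EQ] : evp iota h 'X = 0 by rewrite evX.
  have : evc u 'X = 0 by rewrite EQ rmorphM /= uG mulr0.
  by rewrite evX => /eqP; rewrite (negPf u20).
pose s0 := ((size (lead_coef G)).-1, (size G).-1).
have i0 : insupp G s0 by rewrite /insupp /= -/(lead_coef G) -/(lead_coef _) !lead_coef_eq0.
have lt1 : (s0.2 < size G)%N by rewrite /= prednK ?size_poly_gt0.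
have lt2 : (s0.1 < sizeY G)%N.
  apply: leq_trans (max_size_lead_coefXY _).
  by rewrite /= prednK ?size_poly_gt0 ?lead_coef_eq0.
(* A single monomial could not vanish at [u], whose coordinates are nonzero. *)
have [s1 i1 n1] : exists2 s1, insupp G s1 & s1 != s0.
  apply: contrapT => ne.
  have all0 s : insupp G s -> s = s0.
    by move=> i; apply/eqP; apply: contraT => ns; case: ne; exists s.
  move/eqP: uG; rewrite evp_pairs (bigD1 (Ordinal lt1, Ordinal lt2)) //= big1.
    by rewrite addr0 !mulf_eq0 !expf_eq0 (negPf u10) (negPf u20) !andbF !orbF (negPf i0).
  move=> [j i] ne'; rewrite /=; have [->|ns] := eqVneq G`_j`_i 0.
    by rewrite !mul0r.
  have E : ((i : nat), (j : nat)) = s0 by apply: all0.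
  case/eqP: ne'; congr (_, _); apply/val_inj; rewrite /=.
    by rewrite -[RHS]/(s0.2) -E.
  by rewrite -[RHS]/(s0.1) -E.
pose p : int := s1.1%:Z - s0.1%:Z; pose q : int := s1.2%:Z - s0.2%:Z.
pose g := gcdz p q.
have g0 : g != 0.
  rewrite gcdz_eq0; apply: contra n1 => /andP[]; rewrite !subr_eq0 => /eqP[e1] /eqP[e2].
  by rewrite [s1]surjective_pairing [s0]surjective_pairing e1 e2.
have [p0 Ep] : exists p0, p = p0 * g by apply/dvdzP/dvdz_gcdl.
have [q0 Eq] : exists q0, q = q0 * g by apply/dvdzP/dvdz_gcdr.
have [a [b Eab]] : exists a b : int, a * p0 + b * q0 = 1.
  have [a [b E]] := Bezoutz p q; exists a, b; apply: (mulIf g0).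
  by rewrite mul1r mulrDl -!mulrA -Ep -Eq E.
(* By the Bezout relation, [nn s] is the position of [s] on the line: s = s0 + nn s (p0, q0). *)
pose nn (s : nat * nat) : int := a * (s.1%:Z - s0.1%:Z) + b * (s.2%:Z - s0.2%:Z).
have nnE s : insupp G s ->
    s.1%:Z - s0.1%:Z = nn s * p0 /\ s.2%:Z - s0.2%:Z = nn s * q0.
  move=> i; have := coll s0 s1 s i0 i1 i; rewrite /cross -/p -/q Ep Eq /nn.
  set x := s.1%:Z - _; set y := s.2%:Z - _ => E.
  have E' : p0 * y = q0 * x by apply: (mulIf g0); move: E; lia.
  have aux (z : int) : z = z * (a * p0 + b * q0) by rewrite Eab mulr1.
  split; rewrite [LHS]aux; apply/eqP; rewrite -subr_eq0; apply/eqP.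
    by transitivity (b * (q0 * x - p0 * y)); [ring | rewrite E' subrr mulr0].
  by transitivity (a * (p0 * y - q0 * x)); [ring | rewrite E' subrr mulr0].
pose T : finType := ('I_(size G) * 'I_(sizeY G))%type.
pose sT (x : T) : nat * nat := (x.2 : nat, x.1 : nat).
(* A common shift that makes the exponents of [w] in [W] natural numbers. In the support only [s0]
   gets exponent [M], so [W] is nonzero. *)
pose M := (\sum_(x : T) `|nn (sT x)|)%N.
have nnM x : exists e : nat, nn (sT x) + M%:Z = e%:Z.
  have le : (`|nn (sT x)| <= M)%N by rewrite /M (bigD1 x) //= leq_addr.
  by exists `|(nn (sT x) + M%:Z)%R|%N; rewrite gez0_abs //; lia.
pose e x := `|(nn (sT x) + M%:Z)%R|%N.
have eE x : (e x)%:Z = nn (sT x) + M%:Z.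
  by rewrite /e; have [e' ->] := nnM x.
pose W : {poly C} := \sum_(x : T) G`_x.1`_x.2 *: 'X^(e x).
pose w := h.1 ^ p0 * h.2 ^ q0.
have w0 : w != 0 by rewrite mulf_neq0 ?expfz_neq0.
pose x0 : T := (Ordinal lt1, Ordinal lt2).
have W0 : W != 0.
  apply/negP => /eqP /(congr1 (fun P : {poly C} => P`_M)); rewrite coef0 coef_sum.
  rewrite (bigD1 x0) //= big1 ?addr0 => [|x nx].
    have -> : e x0 = M by apply/eqP; rewrite -eqz_nat eE /nn !subrr !mulr0 !add0r.
    by rewrite coefZ coefXn eqxx mulr1 => /eqP; rewrite (negPf i0).
  rewrite coefZ coefXn; have [->|cx] := eqVneq G`_x.1`_x.2 0; first by rewrite mul0r.
  case: eqP => [Me|]; last by rewrite mulr0.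
  have n0x : nn (sT x) = 0 by apply: (addIr M%:Z); rewrite -eE add0r Me.
  have [] := nnE (sT x) cx; rewrite n0x !mul0r => E1 E2.
  case/eqP: nx; rewrite [x]surjective_pairing; congr (_, _); apply/val_inj.
    by apply/eqP; rewrite -eqz_nat -subr_eq0; apply/eqP.
  by apply/eqP; rewrite -eqz_nat -subr_eq0; apply/eqP.
have shift (x : K) (i j : nat) : x != 0 -> x ^+ i = x ^+ j * x ^ (i%:Z - j%:Z).
  by move=> nx; rewrite !exprnP -expfzDr // addrC subrK.
have auxr (a1 b1 a2 b2 cc ww : K) :
  a1 * a2 * (cc * (b1 * b2 * ww)) = ww * (cc * (a1 * b1) * (a2 * b2)) by ring.
have Ww : root (map_poly iota W) w.
  rewrite /root; pose m0 := h.1 ^+ s0.1 * h.2 ^+ s0.2.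
  have m00 : m0 != 0 by rewrite mulf_neq0 ?expf_neq0.
  rewrite -(mulrI_eq0 _ (mulfI m00)) rmorph_sum horner_sum mulr_sumr.
  suff -> : \sum_(x : T) m0 * (map_poly iota (G`_x.1`_x.2 *: 'X^(e x))).[w] =
      w ^+ M * evp iota h G by rewrite hG mulr0.
  rewrite evp_pairs mulr_sumr; apply: eq_bigr => x _.
  rewrite map_polyZ /= map_polyXn hornerZ hornerXn.
  have [->|cx] := eqVneq G`_x.1`_x.2 0; first by rewrite rmorph0 !(mul0r, mulr0).
  have [E1 E2] := nnE (sT x) cx.
  have -> : w ^+ e x = w ^ nn (sT x) * w ^+ M by rewrite exprnP eE expfzDr.
  have -> : w ^ nn (sT x) = h.1 ^ (nn (sT x) * p0) * h.2 ^ (nn (sT x) * q0).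
    by rewrite /w exprzMl ?unitfE ?expfz_neq0 // !exprz_exp !(mulrC (nn _)).
  rewrite -E1 -E2 /m0 (shift h.1 x.2 s0.1 h10) (shift h.2 x.1 s0.2 h20) /=.
  exact: auxr.
have [c Ec] := alg_const W0 Ww.
(* With negative exponents moved to the other side, h.1^p0 h.2^q0 = c says that a polynomial [B]
   vanishes at [h]. It is then a multiple of [G], so it vanishes at [u], and c is a root of
   unity. *)
pose pos (z : int) := if z is Posz m then m else 0%N.
pose neg (z : int) := if z is Negz m then m.+1 else 0%N.
have posneg z : z = (pos z)%:Z - (neg z)%:Z by case: z => m /=; rewrite ?subr0 ?sub0r ?NegzE.
have [B evBn] : exists B, forall (L : fieldType) (io : {rmorphism C -> L}) k,
    evp io k B = k.1 ^+ pos p0 * k.2 ^+ pos q0 - io c * (k.1 ^+ neg p0 * k.2 ^+ neg q0).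
  move: (pos p0) (pos q0) (neg p0) (neg q0) => i j i' j'.
  exists ('Y ^+ i * 'X ^+ j - c%:P%:P * ('Y ^+ i' * 'X ^+ j')) => L io k.
  rewrite evB !rmorphM !rmorphXn /=.
  by rewrite evCC evX evY.
have hB : evp iota h B = 0.
  rewrite evBn -Ec (shift h.1 (pos p0) (neg p0) h10).
  rewrite (shift h.2 (pos q0) (neg q0) h20) -!posneg /w.
  by rewrite mulrACA (mulrC (_ * _) (_ ^ _ * _)) subrr.
have [Q EB] := Gdvd _ hB.
have uB : evc u B = 0 by rewrite EB rmorphM /= uG mulr0.
have cn : c ^+ n = 1.
  move/eqP: uB; rewrite evBn subr_eq0 => /eqP.
  move/(congr1 (fun x => x ^+ n)); rewrite !exprMn -!exprM !(mulnC _ n) !exprM.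
  by rewrite u1n u2n !expr1n !mulr1.
have : h.1 ^ (p0 * n%:Z) * h.2 ^ (q0 * n%:Z) = 1.
  have -> : h.1 ^ (p0 * n%:Z) * h.2 ^ (q0 * n%:Z) = w ^ n%:Z.
    by rewrite /w exprzMl ?unitfE ?expfz_neq0 // !exprz_exp.
  by rewrite -exprnP Ec -rmorphXn /= cn rmorph1.
case/mi => /eqP + /eqP; rewrite !mulf_eq0 !eqz_nat !(gtn_eqF n0) !orbF => /eqP p00 /eqP q00.
by move: Eab; rewrite p00 q00 !mulr0.
Qed.
End SupportNoncollinear.

(** * Torsion points on a curve *)

Section FourCosets.
Variables (V : finZmodType) (S : {set V}).

(** Doubling maps the elements whose double is in [S] onto [S], because each element of [S] is a
    double in [V]. The fibres are translates of the four elements killed by 2, so there are 4 |S|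
    such elements, in four cosets of [S]. *)
Lemma four_cosets : 0 \in S -> (forall x y, x \in S -> y \in S -> x - y \in S) ->
  (forall x, x \in S -> exists y, x = y *+ 2) -> #|[set x : V | x *+ 2 == 0]| = 4%N ->
  exists t : 'I_4 -> V, [/\ forall i, t i *+ 2 \in S,
    forall i j, t i - t j \in S -> i = j &
    forall x, x *+ 2 \in S -> exists i, x - t i \in S].
Proof.
move=> S0 SB Sdiv c4; pose H := [set x : V | x *+ 2 \in S].
have SN x : x \in S -> - x \in S by move=> xS; rewrite -sub0r SB.
have SD x y : x \in S -> y \in S -> x + y \in S.
  by move=> xS yS; rewrite -[y]opprK SB ?SN.
have cH : #|H| = (4 * #|S|)%N.
  rewrite -sum1_card (partition_big (fun x => x *+ 2) (mem S)) /=; last first.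
    by move=> x; rewrite inE.
  rewrite mulnC -sum_nat_const; apply: eq_bigr => s sS.
  have [y Ey] := Sdiv s sS.
  rewrite sum1dep_card -c4 -[RHS](card_imset _ (addrI y)); apply: eq_card => x.

  rewrite inE [_ \in H]inE; apply/andP/imsetP => [[_ /eqP E]|[z]].
    exists (x - y); last by rewrite addrC subrK.
    by rewrite inE mulrnBl E Ey subrr.
  by rewrite inE => /eqP E ->; rewrite mulrnDl E addr0 -Ey sS.
pose R : rel V := fun x y => x - y \in S.
have eqR : {in H & &, equivalence_rel R}.
  move=> x y z _ _ _; split; first by rewrite /R subrr.
  move=> xy; apply/idP/idP => h.
    by rewrite /R -[y](subrK x) -addrA SD // -opprB SN.
  by rewrite /R -[x](subrK y) -addrA SD.
have partP := equivalence_partitionP eqR; set P := equivalence_partition R H in partP.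
have cP : #|P| = 4%N.
  have S1 : (0 < #|S|)%N by apply/card_gt0P; exists 0.
  have : #|H| = (#|P| * #|S|)%N.
    apply: card_uniform_partition partP => A /imsetP[x xH ->].
    have inj : injective (fun s => x - s) by move=> a b /addrI /oppr_inj.
    rewrite -[RHS](card_imset _ inj); apply: eq_card => y; rewrite inE.
    apply/andP/imsetP => [[yH xy]|[s sS ->]].
      by exists (x - y); rewrite // opprB addrC subrK.
    split; last by rewrite /R opprB addrC subrK.
    rewrite inE mulrnBl; apply: SB; first by move: xH; rewrite inE.
    by rewrite mulr2n SD.
  by rewrite cH => /eqP; rewrite eqn_pmul2r // => /eqP.
have [/eqP covP trivP nP0] := and3P partP.
have blk (B : {set V}) : B \in P -> exists2 x, x \in B & x \in H.
  move=> BP; have /set0Pn[x xB] : B != set0 by apply: contraNneq nP0 => <-.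
  by exists x; rewrite // -covP; apply/bigcupP; exists B.
pose B (i : 'I_4) : {set V} := enum_val (cast_ord (esym cP) i).
have BP i : B i \in P by apply: enum_valP.
pose t i := odflt 0 [pick x in B i].
have tB i : t i \in B i.
  rewrite /t; case: pickP => [x|no] //=; have [x xB _] := blk _ (BP i).
  by have := no x; rewrite xB.
have tH i : t i \in H by rewrite -covP; apply/bigcupP; exists (B i).
exists t; split=> [i|i j ij|x xS].
- by have := tH i; rewrite inE.
- have BE k : B k = pblock P (t k) by rewrite (def_pblock trivP (BP k) (tB k)).
  have : t j \in pblock P (t i).
    by rewrite (pblock_equivalence_partition eqR) ?tH.
  rewrite -BE => tj; apply: (can_inj (cast_ordKV cP)); apply: enum_val_inj.
  by rewrite -/(B i) -/(B j) [B j]BE (def_pblock trivP (BP i) tj).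
- have xH : x \in H by rewrite inE.
  have xc : x \in cover P by rewrite covP.
  have := pblock_mem xc => bP; pose i := cast_ord cP (enum_rank_in bP (pblock P x)).
  have Bi : B i = pblock P x by rewrite /B /i cast_ordK enum_rankK_in.
  exists i; rewrite -[_ \in S]/(R x (t i)).
  by rewrite -(pblock_equivalence_partition eqR) ?tH // -Bi tB.
Qed.
End FourCosets.

Lemma ord_mulr2n (m : nat) (x : 'I_m.+2) : x *+ 2 = 0 <-> (m.+2 %| x + x)%N.
Proof.
split=> [/(congr1 val) /= /eqP|h]; first by [].
by apply/val_inj/eqP.
Qed.

Lemma card_two_torsion (m : nat) : ~~ odd m ->
  #|[set x : 'I_m.+2 * 'I_m.+2 | x *+ 2 == 0]| = 4%N.
Proof.
move=> om; have lt : ((m./2).+1 < m.+2)%N by lia.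
pose z : 'I_m.+2 := Ordinal lt.
have E (x : 'I_m.+2) : (x *+ 2 == 0) = (x \in [set 0; z]).
  rewrite !inE; apply/eqP/orP => [/ord_mulr2n/dvdnP[k Ek]|].
    have := ltn_ord x => xm; have k2 : (k < 2)%N.
      by rewrite -(ltn_pmul2r (ltn0Sn m.+1)) -Ek; lia.
    case: k k2 Ek => [|[|]] // _ Ek; [left|right]; apply/eqP/val_inj => /=; lia.
  case=> /eqP ->; first by rewrite mul0rn.
  by apply/ord_mulr2n; rewrite /= (_ : _ + _ = m.+2)%N //; lia.
have -> : [set x : 'I_m.+2 * 'I_m.+2 | x *+ 2 == 0] = setX [set 0; z] [set 0; z].
  apply/setP => -[x y]; rewrite in_setX -!E inE -[_ == 0]/((_ == _) && (_ == _)).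
  by rewrite !mulr2n.
by rewrite cardsX cards2.
Qed.

HB.instance Definition _ (A B : finZmodType) := GRing.Zmodule.on (A * B)%type.

(** * Translations by the torsion points of level m + 2 *)

Section TorsionAction.
Variables (C : numClosedFieldType) (m : nat) (w : C).
Hypothesis pw : m.+2.-primitive_root w.
Local Notation V := ('I_m.+2 * 'I_m.+2)%type.
Implicit Types (t u v : V) (G H : {poly {poly C}}).

Definition tpt v : C * C := (w ^+ v.1, w ^+ v.2).
Definition ttr v : {poly {poly C}} -> {poly {poly C}} := tr (tpt v).1 (tpt v).2.
(** The eigenvalue of translation by [v] on the monomial with exponents [s]. *)
Definition tchar v (s : nat * nat) : C := (tpt v).1 ^+ s.1 * (tpt v).2 ^+ s.2.

Lemma tptD u v : tpt (u + v) = ((tpt u).1 * (tpt v).1, (tpt u).2 * (tpt v).2).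
Proof. by rewrite /tpt /= !(prim_expr_mod pw) -!exprD. Qed.

Lemma tors_mulrn v : v *+ m.+2 = 0.
Proof.
have E k : v *+ k = (v.1 *+ k, v.2 *+ k).
  by elim: k => // k IH; rewrite mulrS IH !mulrS.
by rewrite E !Zp_mulrn; congr (_, _); apply/val_inj; rewrite /= modnMl.
Qed.

Lemma tptMn v k : tpt (v *+ k) = ((tpt v).1 ^+ k, (tpt v).2 ^+ k).
Proof.
elim: k => [|k IH]; first by rewrite !expr0.
by rewrite mulrS tptD IH !exprS.
Qed.

Lemma root_neq0 k : w ^+ k != 0.
Proof. rewrite expf_neq0 //; apply/negP => /eqP w0; have := prim_expr_order pw.
by rewrite w0 expr0n => /esym/eqP; rewrite oner_eq0. Qed.

Lemma tpt_neq0 v : ((tpt v).1 != 0) * ((tpt v).2 != 0).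
Proof. by split; apply: root_neq0. Qed.

Lemma tcharD u v s : tchar (u + v) s = tchar u s * tchar v s.
Proof. by rewrite /tchar tptD !exprMn mulrACA. Qed.

Lemma tchar_neq0 v s : tchar v s != 0.
Proof. by rewrite mulf_neq0 // expf_neq0 // tpt_neq0. Qed.

Lemma tchar0 s : tchar 0 s = 1.
Proof. by rewrite /tchar !expr1n mulr1. Qed.

Lemma ttr0 H : ttr 0 H = H.
Proof. by apply/polyP => j; apply/polyP => i; rewrite coef_tr !expr1n !mul1r. Qed.

Lemma ttrD u v H : ttr u (ttr v H) = ttr (u + v) H.
Proof. by rewrite /ttr trM tptD. Qed.

Lemma ttrK v H : ttr (- v) (ttr v H) = H.
Proof. by rewrite ttrD addNr ttr0. Qed.

Lemma ttrCM v c H : ttr v (c%:P%:P * H) = c%:P%:P * ttr v H.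
Proof. by rewrite /ttr rmorphM /= trC comp_polyC. Qed.

Lemma ttr_eq0 v H : (ttr v H == 0) = (H == 0).
Proof. by rewrite /ttr tr_eq0 ?tpt_neq0. Qed.

Lemma ttr_size v H : (size (ttr v H) = size H) * (sizeY (ttr v H) = sizeY H).
Proof. by rewrite /ttr tr_size ?tr_sizeY ?tpt_neq0. Qed.

Lemma ttr_dbl v H : ttr v (dbl H) = dbl (ttr (v *+ 2) H).
Proof. by rewrite /ttr tr_dbl tptMn. Qed.

Lemma coef_ttr v H i j : (ttr v H)`_j`_i = tchar v (i, j) * H`_j`_i.
Proof. exact: coef_tr. Qed.

Lemma insupp_ttr v H s : insupp (ttr v H) s = insupp H s.
Proof. by rewrite /insupp coef_ttr mulf_eq0 (negPf (tchar_neq0 _ _)). Qed.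

Lemma ev_ttr u v H : evc (tpt u) (ttr v H) = evc (tpt (u + v)) H.
Proof. by rewrite ev_tr addrC tptD. Qed.

(** The stabilizer of the curve G = 0: translation by [t] multiplies [G] by a constant. Only the
    support of [G] enters, so these [t] also stabilize every polynomial with support inside that of
    [G], in particular its conjugates. *)
Definition tstab G : {set V} :=
  [set t | `[< exists c, forall s, insupp G s -> tchar t s = c >]].

Lemma tstabP G t :
  reflect (exists c, forall s, insupp G s -> tchar t s = c) (t \in tstab G).
Proof. by rewrite inE; apply/asboolP. Qed.

Lemma tstab0 G : 0 \in tstab G.
Proof. by apply/tstabP; exists 1 => s _; apply: tchar0. Qed.

Lemma tstabB G x y : x \in tstab G -> y \in tstab G -> x - y \in tstab G.
Proof.
move=> /tstabP[c Ec] /tstabP[d Ed]; apply/tstabP; exists (c / d) => s sG.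
rewrite -(Ec _ sG) -(Ed _ sG); apply: (canRL (mulfK (tchar_neq0 _ _))).
by rewrite -tcharD subrK.
Qed.

Lemma tstabD G x y : x \in tstab G -> y \in tstab G -> x + y \in tstab G.
Proof.
move=> xS yS; rewrite -[y]opprK tstabB // -sub0r tstabB ?tstab0 //.
Qed.

Lemma tstab_ttr G t c : c != 0 -> ttr t G = c%:P%:P * G -> t \in tstab G.
Proof.
move=> c0 E; apply/tstabP; exists c => -[i j] sG.
apply: (mulIf sG); rewrite -coef_ttr E coefCM /=.
by rewrite coefCM.
Qed.

Lemma ttr_tstab G H t : t \in tstab G ->
  (forall s, insupp H s -> insupp G s) ->
  exists2 c, c != 0 & ttr t H = c%:P%:P * H.
Proof.
move=> /tstabP[c Ec] sub.
have E d : (forall s, insupp G s -> tchar t s = d) -> ttr t H = d%:P%:P * H.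
  move=> Ed; apply/polyP => j; apply/polyP => i; rewrite coef_ttr coefCM.
  rewrite coefCM; have [->|ne] := eqVneq H`_j`_i 0; first by rewrite !mulr0.
  by rewrite (Ed (i, j)) //; apply: sub.
have [c0|c0] := eqVneq c 0; last by exists c => //; apply: E.
exists 1; first exact: oner_neq0.
by apply: E => s /Ec E'; have := tchar_neq0 t s; rewrite E' c0 eqxx.
Qed.

(** Membership of [x] says that the scalar product of [x] and [s - s0] is 0 modulo m + 2 for each
    [s] in the support. By Cramer's rule the cross product times a coordinate of [x] is a multiple
    of m + 2, hence of twice the cross product; so both coordinates are even. *)
Lemma tstab_div2 G s0 s1 s2 : insupp G s0 -> insupp G s1 -> insupp G s2 ->
  cross s0 s1 s2 != 0 -> ((2 * cross s0 s1 s2)%R %| m.+2%:Z)%Z ->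
  forall x, x \in tstab G -> exists y, x = y *+ 2.
Proof.
move=> i0 i1 i2 d0 /dvdzP[e Ee] x /tstabP[c Ec].
have dv s : insupp G s ->
    exists k : int, x.1%:Z * (s.1%:Z - s0.1%:Z) + x.2%:Z * (s.2%:Z - s0.2%:Z) = k * m.+2%:Z.
  move=> i; apply/dvdzP.
  have /eqP := Ec _ i; rewrite -(Ec _ i0) /tchar /= -!exprM -!exprD.
  rewrite (eq_prim_root_expr pw) -eqz_nat -!modz_nat eqz_mod_dvd !PoszD !PoszM.
  by congr (_ %| _)%Z; rewrite ?mulrDr ?mulrN; ring.
have [k1 E1] := dv _ i1; have [k2 E2] := dv _ i2.
move: Ee d0 E1 E2; rewrite /cross.
set p1 := s1.1%:Z - _; set p2 := s1.2%:Z - _; set q1 := s2.1%:Z - _; set q2 := s2.2%:Z - _.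
move=> Ee d0 E1 E2; rewrite Ee in E1 E2.
have even (a : nat) (k : int) : (p1 * q2 - p2 * q1) * a%:Z = (p1 * q2 - p2 * q1) * (2 * k) ->
   exists b, a = (b + b)%N.
  by move/(mulfI d0) => E; exists `|k|%N; lia.
have [y1 Ey1] : exists b, x.1 = (b + b)%N :> nat.
  apply: (even _ (e * (q2 * k1 - p2 * k2))).
  transitivity (q2 * (x.1%:Z * p1 + x.2%:Z * p2) - p2 * (x.1%:Z * q1 + x.2%:Z * q2)); first by ring.
  by rewrite E1 E2; ring.
have [y2 Ey2] : exists b, x.2 = (b + b)%N :> nat.
  apply: (even _ (e * (p1 * k2 - q1 * k1))).
  transitivity (p1 * (x.1%:Z * q1 + x.2%:Z * q2) - q1 * (x.1%:Z * p1 + x.2%:Z * p2)); first by ring.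
  by rewrite E1 E2; ring.
have lt1 : (y1 < m.+2)%N by have := ltn_ord x.1; lia.
have lt2 : (y2 < m.+2)%N by have := ltn_ord x.2; lia.
exists (Ordinal lt1, Ordinal lt2); rewrite [x]surjective_pairing.
congr (_, _); apply/val_inj => /=.
  by rewrite -Ey1 modn_small.
by rewrite -Ey2 modn_small.
Qed.

(** * Translates and conjugates of a generator *)

Section Generator.
Variables (K : fieldType) (iota : {rmorphism C -> K}) (h : K * K) (G : {poly {poly C}}).
Hypothesis gG : isgen iota h G.

(** The translate of [h] by [- v], which is a point of the curve [ttr v G]. *)
Definition rot v : K * K := (iota (tpt (- v)).1 * h.1, iota (tpt (- v)).2 * h.2).

Lemma evp_rot u v H : evp iota (rot v) (ttr u H) = evp iota h (ttr (u - v) H).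
Proof.
by rewrite !ev_tr tptD !rmorphM !mulrA.
Qed.

Lemma isgen_rot v : isgen iota (rot v) (ttr v G).
Proof.
have [G0 hG dv] := gG; split; first by rewrite ttr_eq0.
  by rewrite evp_rot subrr ttr0.
move=> H; rewrite -[H](ttrK (- v)) opprK evp_rot subrr ttr0 => /dv[Q ->].
by exists (ttr v Q); rewrite /ttr rmorphM.
Qed.

Lemma insupp_sizes H : (forall s, insupp H s -> insupp G s) ->
  (size H <= size G)%N /\ (sizeY H <= sizeY G)%N.
Proof.
move=> sub; split.
  apply/size_le_supp => i j /(sub (i, j)); rewrite /insupp /=.
  by case: ltnP => // le; rewrite (nth_default 0 le) coef0 eqxx.
apply/sizeY_le => i j /(sub (i, j)); rewrite /insupp /=.
case: ltnP => // le; rewrite (nth_default 0) ?eqxx //.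
exact: leq_trans (max_size_coefXY _ _) le.
Qed.

(** The support condition keeps the bidegree within that of [G], so a translate of [H] in the ideal
    of [h] leaves no room for a nonconstant cofactor. *)
Lemma gen_insupp H t : H != 0 -> (forall s, insupp H s -> insupp G s) ->
  evp iota h (ttr t H) = 0 -> exists2 c, c != 0 & H = c%:P%:P * ttr (- t) G.
Proof.
move=> H0 /insupp_sizes[s1 s2] hH.
have [|||c c0 E] := gen_small gG _ hH; rewrite ?ttr_eq0 ?ttr_size //.
by exists c => //; rewrite -ttrCM -E ttrK.
Qed.

Lemma evp_ttr_gen t : evp iota h (ttr t G) = 0 -> t \in tstab G.
Proof.
have [G0 _ _] := gG; case/gen_insupp => // c c0 E.
by apply: (tstab_ttr c0); rewrite {1}E ttrCM ttrD subrr ttr0.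
Qed.

Lemma gen_nonconst : (1 < size G)%N || (1 < sizeY G)%N.
Proof.
rewrite -[_ || _]negbK negb_or -!leqNgt; apply/negP => /andP[s1 s2].
have [G0 + _] := gG; rewrite (biv_const s1 s2) evCC => /eqP.
rewrite fmorph_eq0 => /eqP c0.
by move: G0; rewrite (biv_const s1 s2) c0 !polyC0 eqxx.
Qed.

(* [dbl H] is invariant, up to constants, under the four translations [t i], so it
   would be divisible by four coprime translates of [G], of total bidegree four
   times that of [G]; but its bidegree is at most twice that of [G]. *)
Lemma dbl_notin_gen (t : 'I_4 -> V) H :
  (forall i, t i *+ 2 \in tstab G) -> (forall i j, t i - t j \in tstab G -> i = j) ->
  H != 0 -> (forall s, insupp H s -> insupp G s) ->
  evp iota h (dbl H) != 0.
Proof.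
move=> t2 tinj H0 sub; apply/negP => /eqP hH.
have [G0 _ _] := gG.
have [||x|Q E] := @gens_dvd _ _ iota
  [seq (rot (t i), ttr (t i) G) | i <- enum 'I_4] (dbl H).
- by move=> x /mapP[i _ ->]; apply: isgen_rot.
- rewrite pairwise_map; apply/(pairwiseP ord0) => i j.
  rewrite !inE size_enum_ord => i4 j4 ij /=; rewrite evp_rot.
  apply/negP => /eqP /evp_ttr_gen /tinj/eqP.
  by rewrite nth_uniq ?enum_uniq ?size_enum_ord // gtn_eqF.
- move=> /mapP[i _ ->] /=; rewrite -[dbl H](ttrK (- t i)) opprK evp_rot subrr ttr0.
  have t2N : (- t i) *+ 2 \in tstab G by rewrite mulNrn -sub0r tstabB ?tstab0.
  have [c _ E] := ttr_tstab t2N sub.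
  by rewrite ttr_dbl E !rmorphM /= hH mulr0.
have dH0 : dbl H != 0.
  apply: contraNneq H0 => dH0; apply/eqP/polyP => j; apply/polyP => i.
  have := coef_dbl H (i * 2) (j * 2); by rewrite dH0 !coef0 !dvdn_mull // !mulnK.
have [s1 s2] := insupp_sizes sub.
have := size_dbl H; have := sizeY_dbl H.
have prod0 : \prod_(i < 4) ttr (t i) G != 0.
  by apply/prodf_neq0 => i _; rewrite ttr_eq0.
have Q0 : Q != 0 by apply: contraNneq dH0 => Q0; rewrite E Q0 mul0r.
rewrite E big_map big_enum /= size_mul // sizeYM //.
rewrite size_prod => [|i _]; last by rewrite ttr_eq0.
rewrite [sizeY (\prod_(i < 4) _)]sizeYE rmorph_prod size_prod => [|i _];
  last by rewrite swapXY_eq0 ttr_eq0.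
under eq_bigr do rewrite -sizeYE ttr_size.
under [in X in _ -> X -> _]eq_bigr do rewrite ttr_size.
rewrite !sum_nat_const !card_ord.
have := gen_nonconst; have := Q0; rewrite -size_poly_gt0.
have := Q0; rewrite -sizeY_gt0.
have := G0; rewrite -size_poly_gt0; have := G0; rewrite -sizeY_gt0; move: s1 s2.
move: (size G) (sizeY G) (size H) (sizeY H) (size Q) (sizeY Q) => a b c d e f; clear; lia.
Qed.

Lemma leq_pred_double a b : (a <= b)%N -> (a.-1 <= b.-1.*2)%N.
Proof. lia. Qed.

Lemma leq_double_pred a b : (a <= b)%N -> (a.-1.*2 <= b.-1.*2)%N.
Proof. lia. Qed.

Section Cover.
Variables (s0 s1 s2 : nat * nat).
Hypotheses (i0 : insupp G s0) (i1 : insupp G s1) (i2 : insupp G s2).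
Hypotheses (d0 : cross s0 s1 s2 != 0) (dm : ((2 * cross s0 s1 s2)%R %| m.+2%:Z)%Z).

Definition small_notin H := [/\ evp iota h H != 0,
  ((size H).-1 <= (size G).-1.*2)%N & ((sizeY H).-1 <= (sizeY G).-1.*2)%N].

Lemma half_reps : exists t : 'I_4 -> V,
  [/\ forall i, t i *+ 2 \in tstab G, forall i j, t i - t j \in tstab G -> i = j &
      forall x, x *+ 2 \in tstab G -> exists i, x - t i \in tstab G].
Proof.
have em : ~~ odd m by have [e Ee] := dvdzP dm; lia.
exact: four_cosets (tstab0 G) (@tstabB G) (tstab_div2 i0 i1 i2 d0 dm) (card_two_torsion em).
Qed.

Lemma conj_tpt (k : nat) (U : {set V}) : coprime k m.+2 ->
  (forall u, u \in U -> evc (tpt u) G = 0) ->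
  exists G', [/\ G' != 0, forall s, insupp G' s -> insupp G s &
    forall u, u \in U -> evc (tpt (u *+ k)) G' = 0].
Proof.
move=> co GU; have [G0 _ _] := gG.
have [|G' [G'0 sub G'U]] := @conj_poly C m.+2 w k
    [seq (u.1 : nat, u.2 : nat) | u <- enum U] G pw co G0.
  by move=> _ /mapP[u uU ->] /=; apply: GU; rewrite mem_enum in uU.
exists G'; split=> // [[i j]|u uU]; first exact: sub.
rewrite tptMn /= -!exprM !(mulnC _ k); apply: (G'U (u.1 : nat, u.2 : nat)).
by apply/mapP; exists u; rewrite ?mem_enum.
Qed.

Lemma evc_tstab H u s : (forall s', insupp H s' -> insupp G s') -> s \in tstab G ->
  evc (tpt (u + s)) H = 0 -> evc (tpt u) H = 0.
Proof.
move=> sub sS; have [c c0 E] := ttr_tstab sS sub.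
rewrite -ev_ttr E evM evCC => /eqP.
by rewrite mulf_eq0 (negPf c0) => /eqP.
Qed.

Variable t : 'I_4 -> V.
Hypotheses (t2 : forall i, t i *+ 2 \in tstab G)
  (tinj : forall i j, t i - t j \in tstab G -> i = j)
  (tsurj : forall x, x *+ 2 \in tstab G -> exists i, x - t i \in tstab G).

(* Write m + 2 = a 2^N with a odd and let j be minimal such that a 2^j (u - v) is
   in the stabilizer for all u, v in U. The conjugation u |-> k u with
   k = 1 + a 2^(j-1) if j >= 2, and with k = 2 + a if j <= 1, moves u, respectively
   2 u, by a fixed vector plus an element of half the stabilizer. *)
Lemma cover_generic (U : {set V}) :
  (forall u, u \in U -> evc (tpt u) G = 0) ->
  (forall u s, u \in U -> s *+ 2 \in tstab G -> evc (tpt (u + s)) G = 0 -> s \in tstab G) ->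
  exists H : 'I_4 -> {poly {poly C}}, (forall i, small_notin (H i)) /\
    forall u, u \in U -> exists i, evc (tpt u) (H i) = 0.
Proof.
move=> GU GUt; have [U0|[v0 v0U]] := set_0Vmem U.
  exists (fun=> 1); split=> [_|u]; last by rewrite U0 inE.
  by split; rewrite ?rmorph1 ?oner_neq0 ?size_poly1 ?sizeYE ?rmorph1 ?size_poly1.
have [a co2 Em] := pfactor_coprime (isT : prime 2) (ltn0Sn m.+1).
have a_odd : odd a by rewrite -coprime2n.
pose P j := [forall u in U, forall v in U, (u - v) *+ (a * 2 ^ j) \in tstab G].
have exP : exists j, P j.
  exists (logn 2 m.+2); apply/forall_inP => u _; apply/forall_inP => v _.
  by rewrite -Em tors_mulrn tstab0.
case: (ex_minnP exP) => j /forall_inP Pj minj.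
have PjU u v : u \in U -> v \in U -> (u - v) *+ (a * 2 ^ j) \in tstab G.
  by move=> uU vU; have /forall_inP := Pj _ uU; apply.
have [j2|j1] := leqP 2 j.
- pose b := (a * 2 ^ j.-1)%N; pose c := v0 *+ b.
  have Eb : (b * 2 = a * 2 ^ j)%N by rewrite -mulnA -expnSr prednK // ltnW.
  have ub u : u \in U -> exists i, (u - v0) *+ b - t i \in tstab G.
    by move=> uU; apply: tsurj; rewrite -mulrnA Eb PjU.
  (* [b] is a multiple of [a] and, as j >= 2, it is even; so [b.+1] is prime to [a] and to 2. *)
  have co : coprime b.+1 m.+2.
    rewrite Em coprimeMr; apply/andP; split.
      by rewrite /b -addn1 mulnC /coprime gcdnC gcdnMDl gcdn1.
    rewrite coprime_sym coprimeXl // coprime2n /= /b oddM negb_and oddX orbC /= orbF.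
    by case: (j) j2 => [|[]].
  have [G' [G'0 sub G'U]] := conj_tpt co GU.
  have kuE u i : u *+ b.+1 = (u + (c + t i)) + ((u - v0) *+ b - t i).
    rewrite mulrS -addrA; congr (_ + _).
    by rewrite addrACA subrr addr0 /c mulrnBl addrC subrK.
  have G'z u i : u \in U -> (u - v0) *+ b - t i \in tstab G ->
      evc (tpt (u + (c + t i))) G' = 0.
    by move=> uU iS; apply: (evc_tstab sub iS); rewrite -kuE G'U.
  exists (fun i => ttr (c + t i) G'); split=> [i|u uU]; last first.
    by have [i iS] := ub u uU; exists i; rewrite ev_ttr G'z.
  have [sz1 sz2] := insupp_sizes sub.
  split; rewrite ?ttr_size ?leq_pred_double //.
  (* Otherwise [G'] is a translate of [G] up to a constant, and [GUt] puts all [u] in the same class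
     [i]. Differences then show that a 2^(j-1) (u - v) is always in the stabilizer, against the
     minimality of [j]. *)
  apply/negP => /eqP /(gen_insupp G'0 sub)[d dn0 E].
  have uS u : u \in U -> (u - v0) *+ b - t i \in tstab G.
    move=> uU; have [i' iS'] := ub u uU; suff -> : i = i' by [].
    have /eqP := G'z u i' uU iS'; rewrite E evM evCC mulf_eq0 (negPf dn0) orFb.
    rewrite ev_ttr -addrA => /eqP /GUt - /(_ uU) h1; apply/esym/tinj.
    have Et : c + t i' - (c + t i) = t i' - t i by rewrite opprD addrACA subrr add0r.
    by rewrite -Et; apply: h1; rewrite Et mulrnBl tstabB.
  suff /minj : P j.-1 by case: (j) j2 => [|k] // _; rewrite ltnn.
  apply/forall_inP => u uU; apply/forall_inP => v vU.
  have := tstabB (uS _ uU) (uS _ vU).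
  by rewrite opprB addrA subrK -mulrnBl opprB addrA subrK.
- pose c := v0 *+ a.
  have ua u : u \in U -> exists i, (u - v0) *+ a - t i \in tstab G.
    move=> uU; apply: tsurj; rewrite -mulrnA.
    have := PjU _ _ uU v0U; case: (j) j1 => [|[]] // _ h1.
    by rewrite mulrnA mulr2n tstabD //; rewrite muln1 in h1.
  have co : coprime (2 + a) m.+2.
    rewrite Em coprimeMr; apply/andP; split.
      by rewrite /coprime gcdnC addnC gcdnDl -/(coprime _ _) coprime_sym.
    by rewrite coprime_sym coprimeXl // coprime2n oddD a_odd.
  have [G' [G'0 sub G'U]] := conj_tpt co GU.
  have sub' x s : insupp (ttr x G') s -> insupp G s by rewrite insupp_ttr; apply: sub.
  (* Since k u = 2 u + a u, the vanishing of [G'] at k u is a condition on a translate of 2 u; [dbl]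
     pulls it back to [u]. *)
  exists (fun i => dbl (ttr (c + t i) G')); split=> [i|u uU].
    have [sz1 sz2] := insupp_sizes sub.
    have := size_dbl (ttr (c + t i) G'); have := sizeY_dbl (ttr (c + t i) G').
    rewrite !ttr_size => l1 l2.
    split; [|exact: leq_trans l2 (leq_double_pred sz1)|exact: leq_trans l1 (leq_double_pred sz2)].
    by apply: (dbl_notin_gen t2 tinj); [rewrite ttr_eq0 | apply: sub'].
  have [i iS] := ua u uU; exists i.
  rewrite ev_dbl -[ev _ _ _ _]/(evc ((tpt u).1 ^+ 2, (tpt u).2 ^+ 2) _) -tptMn ev_ttr.
  apply: (evc_tstab sub iS).
  have <- : u *+ (2 + a) = u *+ 2 + (c + t i) + ((u - v0) *+ a - t i).
    rewrite mulrnDr -[RHS]addrA; apply: (congr1 (+%R (u *+ 2))).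
    by rewrite addrACA subrr addr0 /c mulrnBl addrC subrK.
  exact: G'U.
Qed.

(** The four polynomials [Ha] take care of the points that also lie on a translate of the curve by
    some [t i] outside the stabilizer. The other points satisfy the separation hypothesis of
    [cover_generic], which supplies four more. *)
Lemma cover_inner (U : {set V}) :
  (forall u, u \in U -> evc (tpt u) G = 0) ->
  exists H : 'I_8 -> {poly {poly C}}, (forall i, small_notin (H i)) /\
    forall u, u \in U -> exists i, evc (tpt u) (H i) = 0.
Proof.
move=> GU.
(* If [t i] stabilizes the curve, the translate is the curve itself; the constant 1 is then a
   placeholder that vanishes nowhere. *)
pose Ha i := if t i \in tstab G then 1 else ttr (t i) G.
pose U' := [set u in U | [forall i, evc (tpt u) (Ha i) != 0]].
have [||Hb [Hbs HbU]] := @cover_generic U'.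
- by move=> u; rewrite inE => /andP[/GU].
- move=> u s; rewrite inE => /andP[uU /forallP uH] sh Gus.
  have [i iS] := tsurj sh; have := uH i; rewrite /Ha.
  have Es : s = t i + (s - t i) by rewrite addrC subrK.
  case: ifP => [tS _|_]; first by rewrite Es tstabD.
  rewrite ev_ttr => /negP[]; apply/eqP.
  by apply: (evc_tstab _ iS) => //; rewrite -addrA -Es.
exists (fun i : 'I_(4 + 4) => match @split 4 4 i with inl a => Ha a | inr b => Hb b end).
split=> [i|u uU].
  case: (@split 4 4 i) => k //; rewrite /Ha; case: ifP => tS.
    by split; rewrite ?rmorph1 ?oner_neq0 ?size_poly1 ?sizeYE ?rmorph1 ?size_poly1.
  split; rewrite ?ttr_size ?leq_pred_double //.
  by apply: contraFneq tS; apply: evp_ttr_gen.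
have [uH|] := boolP [forall i, evc (tpt u) (Ha i) != 0].
  have [|i Ei] := HbU u; first by rewrite inE uU.
  by exists (@rshift 4 4 i); rewrite (unsplitK (inr i)).
case/forallPn => i; rewrite negbK => /eqP Ei.
by exists (@lshift 4 4 i); rewrite (unsplitK (inl i)).
Qed.

End Cover.
End Generator.
End TorsionAction.
Lemma prim_root_exists (C : numClosedFieldType) n : (0 < n)%N ->
  exists w : C, n.-primitive_root w.
Proof.
move=> n0; have [rs Ers] := closed_field_poly_normal ('X^n - 1 : {poly C}).
rewrite (monicP (monic_Xn_sub_1 _ n0)) scale1r in Ers.
have /hasP[w _ pw] : has n.-primitive_root rs; last by exists w.
apply: cyclic.has_prim_root => //.
- by apply/allP => z zrs; rewrite /root_of_unity Ers root_prod_XsubC.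
- by rewrite -separable_prod_XsubC -Ers separable_Xn_sub_1 // pnatr_eq0 -lt0n.
- by rewrite -ltnS -(size_prod_XsubC rs id) -Ers size_XnsubC.
Qed.

(** * Covering the torsion points of all components *)

Section GlobalCover.
Variables (C : numClosedFieldType) (K : fieldType) (iota : {rmorphism C -> K}).
Implicit Types (h k : K * K) (F G H P Q : {poly {poly C}}).

Lemma cover_component h G (U : seq (C * C)) n :
  nonconst iota h.1 -> mult_indep h.1 h.2 -> isgen iota h G -> (0 < n)%N ->
  (forall u, u \in U -> u.1 ^+ n = 1 /\ u.2 ^+ n = 1) ->
  (forall u, u \in U -> evc u G = 0) ->
  exists H : 'I_8 -> {poly {poly C}}, (forall i, small_notin iota h G (H i)) /\
    forall u, u \in U -> exists i, evc u (H i) = 0.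
Proof.
move=> nc mi gG n0; case: U => [|u0 U] Un GU.
  (* With no point to cover, constants serve. In the other case a torsion point on the curve is at
     hand, which is what makes the support noncollinear. *)
  exists (fun=> 1); split=> [_|//].
  by split; rewrite ?rmorph1 ?oner_neq0 ?size_poly1 ?sizeYE ?rmorph1 ?size_poly1.
have [u1 u2] := Un _ (mem_head _ _).
have [[[s0 s1] s2] /= [i0 i1 i2 d0]] := supp_noncollinear nc mi gG n0 u1 u2 (GU _ (mem_head _ _)).
(* The level is a multiple of [n], to contain the given points, and of twice the cross product, to
   make elements of the stabilizer divisible by 2. *)
have [m Em] : exists m, m.+2 = (n * (2 * `|cross s0 s1 s2|))%N.
  exists (n * (2 * `|cross s0 s1 s2|)).-2; move: d0; rewrite -absz_gt0 => d0.
  have : (2 <= n * (2 * `|cross s0 s1 s2|))%N.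
    by rewrite -[X in (X <= _)%N](muln1 2) mulnCA leq_mul2l muln_gt0 n0 d0.
  by case: (n * _)%N => [|[]].
have [w pw] := @prim_root_exists C m.+2 isT.
have nm (x : C) : x ^+ n = 1 -> x ^+ m.+2 = 1 by rewrite Em exprM => ->; rewrite expr1n.
have dm : ((2 * cross s0 s1 s2)%R %| m.+2%:Z)%Z.
  by rewrite Em PoszM dvdz_mull // dvdzE abszM.
have [t [t2 tinj tsurj]] := half_reps pw i0 i1 i2 d0 dm.
pose V := [set v : 'I_m.+2 * 'I_m.+2 | tpt w v \in u0 :: U].
have [|H [Hs HV]] := cover_inner pw gG t2 tinj tsurj (U := V).
  by move=> v; rewrite inE => /GU.
exists H; split=> // u uU; have [/nm e1 /nm e2] := Un u uU.
have [v Ev] : exists v : 'I_m.+2 * 'I_m.+2, u = tpt w v.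
  have [v1 E1] := prim_rootP pw e1; have [v2 E2] := prim_rootP pw e2.
  by exists (v1, v2); apply/eqP; rewrite [u]surjective_pairing xpair_eqE /tpt /= E1 E2 !eqxx.
have vV : v \in V by rewrite inE -Ev.
by have [i Ei] := HV v vV; exists i; rewrite Ev.
Qed.

Definition bideg_le a b P := (size P <= a.+1)%N /\ (sizeY P <= b.+1)%N.

Lemma bideg_leM a b c d P Q : bideg_le a b P -> bideg_le c d Q ->
  bideg_le (a + c) (b + d) (P * Q).
Proof.
have aux (x y e f : nat) : (x <= e.+1)%N -> (y <= f.+1)%N -> ((x + y).-1 <= (e + f).+1)%N by lia.
move=> [s1 s2] [s3 s4]; split; first exact: leq_trans (size_polyMleq _ _) (aux _ _ _ _ s1 s3).
rewrite sizeYE rmorphM /=; move: s2 s4; rewrite !sizeYE => s2 s4.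
exact: leq_trans (size_polyMleq _ _) (aux _ _ _ _ s2 s4).
Qed.

Lemma bideg_leD a b P Q : bideg_le a b P -> bideg_le a b Q -> bideg_le a b (P + Q).
Proof.
move=> [s1 s2] [s3 s4]; split.
  by apply: leq_trans (size_polyD _ _) _; rewrite geq_max s1.
rewrite sizeYE rmorphD /=; move: s2 s4; rewrite !sizeYE => s2 s4.
by apply: leq_trans (size_polyD _ _) _; rewrite geq_max s2.
Qed.

Lemma bideg_leW a b c d P : (a <= c)%N -> (b <= d)%N -> bideg_le a b P -> bideg_le c d P.
Proof. by move=> ac bd [s1 s2]; split; [exact: leq_trans s1 _|exact: leq_trans s2 _]. Qed.

Lemma bideg_le1 a b : bideg_le a b 1.
Proof. by split; rewrite ?sizeYE ?rmorph1 size_poly1. Qed.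

Lemma bideg_le_small h G H : small_notin iota h G H ->
  bideg_le (size G).-1.*2 (sizeY G).-1.*2 H.
Proof. by case=> _ s1 s2; split; [move: s1; case: (size H)|move: s2; case: (sizeY H)]. Qed.

(** Components are adjoined one at a time, and [G * H i + H' i * P] glues the two families in the
    manner of the Chinese remainder theorem: on P = 0 only the first term survives, on G = 0 only
    the second. The number of polynomials stays 8 and the bidegree stays within twice that of [P].
    Nonvanishing is stated at every nonconstant [k] on P = 0, so that a later pair which already
    lies there adds no component. *)
Lemma global_cover_gen (ps : seq (K * K)) F (U : seq (C * C)) n :
  (forall h, h \in ps -> nonconst iota h.1 /\ mult_indep h.1 h.2) ->
  F != 0 -> (forall h, h \in ps -> evp iota h F = 0) -> (0 < n)%N ->
  (forall u, u \in U -> u.1 ^+ n = 1 /\ u.2 ^+ n = 1) ->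
  exists P (H : 'I_8 -> {poly {poly C}}),
    [/\ P != 0 /\ forall h, h \in ps -> evp iota h P = 0,
        forall F', (forall h, h \in ps -> evp iota h F' = 0) -> exists Q, F' = Q * P,
        forall i k, nonconst iota k.1 -> evp iota k P = 0 -> evp iota k (H i) != 0,
        forall i, bideg_le (size P).-1.*2 (sizeY P).-1.*2 (H i) &
        forall u, u \in U -> evc u P = 0 -> exists i, evc u (H i) = 0].
Proof.
move=> + F0 + n0 Un; elim: ps => [|h ps IH] psP psF.
  exists 1, (fun=> 1); split=> // [|F' _|i k _|i|u _].
  - by rewrite oner_neq0.
  - by exists F'; rewrite mulr1.
  - by rewrite rmorph1 => /eqP; rewrite oner_eq0.
  - exact: bideg_le1.
  - by rewrite rmorph1 => /eqP; rewrite oner_eq0.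
have [||P [H [[P0 Pps] Pdv Hk Hs HU]]] := IH.
- by move=> k kps; apply: psP; rewrite inE kps orbT.
- by move=> k kps; apply: psF; rewrite inE kps orbT.
have [Ph|Ph] := eqVneq (evp iota h P) 0.
  exists P, H; split=> // [|F' hF']; first by split=> // k /[!inE] /predU1P[->|/Pps].
  by apply: Pdv => k kps; apply: hF'; rewrite inE kps orbT.
have [nc mi] := psP _ (mem_head _ _).
have [G gG] := gen_exists nc F0 (psF _ (mem_head _ _)).
pose UG := [seq u <- U | evc u G == 0].
have [||H' [H's H'U]] := @cover_component h G UG n nc mi gG n0.
- by move=> u; rewrite mem_filter => /andP[_ /Un].
- by move=> u; rewrite mem_filter => /andP[/eqP].
have [G0 Gh Gdv] := gG.
exists (P * G), (fun i => G * H i + H' i * P); split=> [|F' hF'|i k nk|i|u uU].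
- split; first by rewrite mulf_neq0.
  by move=> k /[!inE] /predU1P[->|/Pps E]; rewrite evM ?E ?Gh ?mul0r ?mulr0.
- have [|Q EQ] := Pdv F'; first by move=> k kps; apply: hF'; rewrite inE kps orbT.
  have /Gdv[Q' EQ'] : evp iota h Q = 0.
    by have /eqP := hF' _ (mem_head _ _); rewrite EQ evM mulf_eq0 (negPf Ph) orbF => /eqP.
  by exists Q'; rewrite EQ EQ' -mulrA (mulrC P).
- move=> /eqP; rewrite evM mulf_eq0 rmorphD /= !evM.
  have [Pk _|Pk /= /eqP Gk] := eqVneq (evp iota k P) 0.
    rewrite Pk mulr0 addr0 mulf_neq0 ?Hk //.
    by apply: contra_neq Ph => Gk; apply: gen_transfer nk gG Gk _ Pk.
  rewrite Gk mul0r add0r mulf_neq0 //; have [H'h _ _] := H's i.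
  by apply: contra_neq H'h => H'k; apply: gen_transfer nk gG Gk _ H'k.
- have := P0; rewrite -size_poly_gt0 => sP; have := G0; rewrite -size_poly_gt0 => sG.
  have := P0; rewrite -sizeY_gt0 => yP; have := G0; rewrite -sizeY_gt0 => yG.
  have bP : bideg_le (size P).-1 (sizeY P).-1 P by split; rewrite prednK.
  have bG : bideg_le (size G).-1 (sizeY G).-1 G by split; rewrite prednK.
  have b1 := bideg_leM bG (Hs i); have b2 := bideg_leM (bideg_le_small (H's i)) bP.
  rewrite size_mul // sizeYM //.
  have aux (p g : nat) : (0 < p)%N -> (0 < g)%N ->
      (g.-1 + p.-1.*2 <= (p + g).-1.-1.*2)%N /\ (g.-1.*2 + p.-1 <= (p + g).-1.-1.*2)%N.
    by clear; lia.
  have [a1 a2] := aux _ _ sP sG; have [a3 a4] := aux _ _ yP yG.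
  by apply: bideg_leD; [apply: bideg_leW b1|apply: bideg_leW b2].
- move=> /eqP; rewrite evM mulf_eq0 => /orP[/eqP Pu|Gu].
    by have [i Ei] := HU u uU Pu; exists i; rewrite rmorphD /= !evM Ei Pu !mulr0 addr0.
  have [|i Ei] := H'U u; first by rewrite mem_filter Gu.
  by exists i; rewrite rmorphD /= !evM Ei (eqP Gu) !mul0r addr0.
Qed.

Lemma global_cover (ps : seq (K * K)) F a b (U : seq (C * C)) n :
  (forall h, h \in ps -> nonconst iota h.1 /\ mult_indep h.1 h.2) ->
  F != 0 -> bideg_le a b F -> (forall h, h \in ps -> evp iota h F = 0) -> (0 < n)%N ->
  (forall u, u \in U -> u.1 ^+ n = 1 /\ u.2 ^+ n = 1) ->
  exists P (H : 'I_8 -> {poly {poly C}}),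
    [/\ forall h, h \in ps -> evp iota h P = 0,
        forall i h, h \in ps -> evp iota h (H i) != 0,
        forall i, bideg_le a.*2 b.*2 (H i) &
        forall u, u \in U -> evc u P = 0 -> exists i, evc u (H i) = 0].
Proof.
move=> psP F0 [sF yF] psF n0 Un.
have [P [H [[P0 Pps] Pdv Hk Hs HU]]] := global_cover_gen psP F0 psF n0 Un.
exists P, H; split=> // [i h hps|i].
  by have [nc _] := psP h hps; apply: Hk => //; apply: Pps.
have [Q EQ] := Pdv F psF; have Q0 : Q != 0 by apply: contraNneq F0 => E; rewrite EQ E mul0r.
move: sF yF; rewrite EQ size_mul // sizeYM // => sF yF.
have := P0; rewrite -size_poly_gt0 => sP; have := Q0; rewrite -size_poly_gt0 => sQ.
have := P0; rewrite -sizeY_gt0 => yP; have := Q0; rewrite -sizeY_gt0 => yQ.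
have aux (p q c : nat) : (0 < p)%N -> (0 < q)%N -> ((q + p).-1 <= c.+1)%N -> (p.-1.*2 <= c.*2)%N.
  by clear; lia.
exact: bideg_leW (aux _ _ _ sP sQ sF) (aux _ _ _ yP yQ yF) (Hs i).
Qed.

End GlobalCover.
(** * The operator X |-> sum H_ij f^i X g^j *)

Lemma mx_ext (R : pzSemiRingType) m p (A B : 'M[R]_(m, p)) :
  (forall v : 'rV_m, v *m A = v *m B) -> A = B.
Proof. by move=> h; apply/row_matrixP => i; rewrite !rowE h. Qed.

Lemma stable_eigen (K : closedFieldType) m (U A : 'M[K]_m) : U != 0 -> stablemx U A ->
  exists a, (U :&: eigenspace A a)%MS != 0.
Proof.
move=> U0; rewrite -stablemx_row_base => /submxP[X EX].
have rU : (0 < \rank U)%N by rewrite lt0n mxrank_eq0.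
have [a] : exists a, root (char_poly X) a.
  by apply/closed_rootP; rewrite size_char_poly eqSS -lt0n.
rewrite -eigenvalue_root_char => /eigenvalueP[u uX u0]; exists a.
have uU0 : u *m row_base U != 0.
  by rewrite mulmx_free_eq0 ?row_base_free.
have le : (u *m row_base U <= U :&: eigenspace A a)%MS.
  rewrite sub_capmx (submx_trans (submxMl _ _)) ?eq_row_base //=; apply/eigenspaceP.
  by rewrite -mulmxA EX mulmxA uX scalemxAl.
by apply: contraNneq uU0 => E; rewrite E submx0 in le.
Qed.

Section PairEvaluation.
Variables (T K : comNzRingType) (phi : {rmorphism T -> K}).

Definition mxev m (A B : 'M[K]_m) (H : {poly {poly T}}) : 'M[K]_m :=
  \sum_(j < size H) \sum_(i < sizeY H) phi H`_j`_i *: (A ^+ i * B ^+ j).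

Lemma mulmx_eigenX m (v : 'rV[K]_m) A a i : v *m A = a *: v -> v *m (A ^+ i) = a ^+ i *: v.
Proof.
move=> vA; elim: i => [|i IH]; first by rewrite !expr0 mulmx1 scale1r.
by rewrite exprS -[A * _]/(A *m _) mulmxA vA -scalemxAl IH scalerA exprS.
Qed.

Lemma mxev_eigen m (v : 'rV[K]_m) A B a b H : v *m A = a *: v -> v *m B = b *: v ->
  v *m mxev A B H = ev phi a b H *: v.
Proof.
move=> vA vB; rewrite (evE _ _ _ (leqnn _) (leqnn _)) mulmx_sumr scaler_suml.
apply: eq_bigr => j _; rewrite mulmx_sumr scaler_suml; apply: eq_bigr => i _.
rewrite -scalemxAr -[_ * _]/(_ *m _) mulmxA (mulmx_eigenX _ vA) -scalemxAl.
by rewrite (mulmx_eigenX _ vB) !scalerA.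
Qed.

Lemma mxev_comm m (A B X : 'M[K]_m) H : GRing.comm X A -> GRing.comm X B ->
  GRing.comm X (mxev A B H).
Proof.
move=> XA XB; apply: commr_sum => j _; apply: commr_sum => i _.
rewrite /GRing.comm -[X * _]/(X *m _) -scalemxAr -[_ * X]/(_ *m X) -scalemxAl.
congr (_ *: _); apply: commrM; exact: commrX.
Qed.

End PairEvaluation.

Lemma map_mxev (T K : comNzRingType) (phi : {rmorphism T -> K}) m (A B : 'M[T]_m) H :
  map_mx phi (mxev idfun A B H) = mxev phi (map_mx phi A) (map_mx phi B) H.
Proof.
rewrite /mxev rmorph_sum; apply: eq_bigr => j _; rewrite rmorph_sum; apply: eq_bigr => i _.
by rewrite /= map_mxZ rmorphM /= !rmorphXn.
Qed.
Lemma stable_capmx_eigen (K : fieldType) m (U A B : 'M[K]_m) a :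
  stablemx U B -> GRing.comm A B -> stablemx (U :&: eigenspace A a)%MS B.
Proof.
move=> UB AB; rewrite sub_capmx (submx_trans (submxMr _ (capmxSl _ _)) UB) /=.
have E := @eigenspaceP _ _ A a _ (U :&: eigenspace A a)%MS.
apply/eigenspaceP; have /E EE := capmxSr U (eigenspace A a).
by rewrite -mulmxA -[B *m A]/(B * A) -AB -[A * B]/(A *m B) mulmxA EE scalemxAl.
Qed.

Section MxevClosed.
Variables (T : comNzRingType) (K : closedFieldType) (phi : {rmorphism T -> K}).

(** The eigenspace of [mxev phi A B H] is stable under the commuting [A] and [B], so it contains a
    common eigenvector of both. *)
Lemma eigenvalue_mxev m (A B : 'M[K]_m) H z : GRing.comm A B ->
  eigenvalue (mxev phi A B H) z ->
  exists a b, [/\ eigenvalue A a, eigenvalue B b & z = ev phi a b H].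
Proof.
move=> AB; set M := mxev phi A B H; rewrite /eigenvalue => E0.
have AM : GRing.comm M A by apply/commr_sym/mxev_comm.
have BM : GRing.comm M B by apply/commr_sym/mxev_comm => //; apply/commr_sym.
have st X : GRing.comm M X -> stablemx (eigenspace M z) X.
  move=> MX; rewrite -(capmx1 (eigenspace M z)) -[X in stablemx X _]cap1mx.
  by rewrite capmx1; apply: stable_capmx_eigen => //; apply: submx1.
have [a Ea0] := stable_eigen E0 (st _ AM).
have [b Eb0] := stable_eigen Ea0 (stable_capmx_eigen a (st _ BM) AB).
have /rowV0Pn[v vE v0] := Eb0; exists a, b.
move: vE; rewrite !sub_capmx => /andP[/andP[/eigenspaceP vM /eigenspaceP vA] /eigenspaceP vB].
split; [by apply/eigenvalueP; exists v | by apply/eigenvalueP; exists v |].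
have := vM; rewrite (mxev_eigen phi H vA vB) => /eqP.
by rewrite -subr_eq0 -scalerBl scaler_eq0 (negPf v0) orbF subr_eq0 => /eqP.
Qed.

End MxevClosed.

(** * Right and left multiplication as commuting operators *)

Section LeftRightMul.
Variables (R : comNzRingType) (r : nat) (f g : 'M[R]_r).

Lemma lin_mul_comm : GRing.comm (lin_mulmxr f : 'M_(r * r)) (lin_mulmx g).
Proof.
apply: mx_ext => v; rewrite -(vec_mxK v) -![_ * _]/(_ *m _) !mulmxA.
by rewrite !mul_vec_lin /= mulmxA.
Qed.

End LeftRightMul.

Section LeftRightMulField.
Variables (K : fieldType) (r : nat).
Implicit Types (f g : 'M[K]_r).

Lemma eigenvalue_lin_mulmxr f a : eigenvalue (lin_mulmxr f : 'M_(r * r)) a -> eigenvalue f a.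
Proof.
case/eigenvalueP => v; rewrite -[v]vec_mxK mul_vec_lin -linearZ /= => /(can_inj mxvecK).
move: (vec_mx v) => X E; rewrite (can2_eq mxvecK vec_mxK) linear0 => /eqP X0.
have [i Xi] : exists i, row i X != 0.
  apply/existsP; apply: contraT; rewrite negb_exists => /forallP h; case: X0.
  by apply/row_matrixP => i; apply/eqP; rewrite row0; have := h i; rewrite negbK.
by apply/eigenvalueP; exists (row i X) => //; rewrite -row_mul E linearZ.
Qed.

Lemma eigenvalue_lin_mulmx g b : eigenvalue (lin_mulmx g^T : 'M_(r * r)) b -> eigenvalue g b.
Proof.
case/eigenvalueP => v; rewrite -[v]vec_mxK mul_vec_lin -linearZ /= => /(can_inj mxvecK) E v0.
apply: eigenvalue_lin_mulmxr; apply/eigenvalueP; exists (mxvec (vec_mx v)^T).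
  rewrite mul_vec_lin /= -linearZ -[g]trmxK -trmx_mul E.
  by apply: (congr1 mxvec); rewrite linearZ.
rewrite mxvec_eq0 in v0; rewrite mxvec_eq0; apply: contraNneq v0 => /(canRL (@trmxK _ _ _)) ->.
by rewrite trmx0.
Qed.

(** The rank one matrix w^T u, with row eigenvectors u of [f] and w of [g], is an eigenvector of
    both X |-> X f and X |-> g^T X. The transpose on [g] allows row vectors on both sides. *)
Lemma lin_mul_eigenvector f g a b : eigenvalue f a -> eigenvalue g b ->
  exists v : 'rV_(r * r), [/\ v != 0, v *m lin_mulmxr f = a *: v & v *m lin_mulmx g^T = b *: v].
Proof.
case/eigenvalueP => u uf u0 /eigenvalueP[w wg w0]; exists (mxvec (w^T *m u)); split.
- rewrite mxvec_eq0; have [/= j wj] := rV0Pn _ w0; have [i ui] := rV0Pn _ u0.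
  apply/negP => /eqP /matrixP /(_ j i); rewrite !mxE big_ord1 mxE => /eqP.
  by rewrite mulf_eq0 (negPf wj) (negPf ui).
- by rewrite mul_vec_lin /= -mulmxA uf -scalemxAr linearZ.
- by rewrite mul_vec_lin /= mulmxA -trmx_mul wg linearZ /= -scalemxAl linearZ.
Qed.

End LeftRightMulField.

Lemma map_lin_mulmxr (R S : comNzRingType) (phi : {rmorphism R -> S}) r (f : 'M[R]_r) :
  map_mx phi (lin_mulmxr f : 'M_(r * r)) = lin_mulmxr (map_mx phi f).
Proof. by apply: map_lin_mx => X; rewrite /= map_mxM. Qed.

Lemma map_lin_mulmx (R S : comNzRingType) (phi : {rmorphism R -> S}) r (f : 'M[R]_r) :
  map_mx phi (lin_mulmx f : 'M_(r * r)) = lin_mulmx (map_mx phi f).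
Proof. by apply: map_lin_mx => X; rewrite /= map_mxM. Qed.

(** * Degrees of the entries of polynomial matrices *)

Section EntrySizes.
Variable C : fieldType.
Implicit Types (d e : nat) (p q : {poly C}).

Lemma size_addM d e p q : (size p <= d.+1)%N -> (size q <= e.+1)%N ->
  (size (p * q)%R <= (d + e).+1)%N.
Proof.
have aux (x y a b : nat) : (x <= a.+1)%N -> (y <= b.+1)%N -> ((x + y).-1 <= (a + b).+1)%N.
  by clear; lia.
by move=> s1 s2; apply: leq_trans (size_polyMleq _ _) (aux _ _ _ _ s1 s2).
Qed.

Lemma size_sum_leq (I : Type) (s : seq I) (P : pred I) (F : I -> {poly C}) d :
  (forall i, P i -> (size (F i) <= d)%N) -> (size (\sum_(i <- s | P i) F i)%R <= d)%N.
Proof.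
move=> h; apply: (big_ind (fun p : {poly C} => (size p <= d)%N)) => //.
  by rewrite size_poly0.
by move=> p q sp sq; apply: leq_trans (size_polyD _ _) _; rewrite geq_max sp.
Qed.

Definition mxsize m1 m2 d (M : 'M[{poly C}]_(m1, m2)) := forall i j, (size (M i j) <= d.+1)%N.

Lemma mxsizeM m1 m2 m3 d e (M : 'M_(m1, m2)) (N : 'M_(m2, m3)) :
  mxsize d M -> mxsize e N -> mxsize (d + e) (M *m N).
Proof.
move=> sM sN i j; rewrite mxE; apply: size_sum_leq => k _; exact: size_addM.
Qed.

Lemma mxsize1 m : mxsize 0 (1 : 'M_m).
Proof. by move=> i j; rewrite mxE; case: (_ == _); rewrite ?size_poly1 ?size_poly0. Qed.

Lemma mxsizeX m d (M : 'M_m) k : mxsize d M -> mxsize (k * d) (M ^+ k).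
Proof.
move=> sM; elim: k => [|k IH]; first exact: mxsize1.
by rewrite exprS mulSn; apply: mxsizeM.
Qed.

Lemma mxsize_sum m1 m2 d (I : Type) (s : seq I) (P : pred I) (F : I -> 'M_(m1, m2)) :
  (forall i, P i -> mxsize d (F i)) -> mxsize d (\sum_(i <- s | P i) F i).
Proof. by move=> h i j; rewrite summxE; apply: size_sum_leq => k /h. Qed.

Lemma mxsize_lin_mulmxr r d (f : 'M_r) : mxsize d f -> mxsize d (lin_mulmxr f : 'M_(r * r)).
Proof.
move=> sf i; case/mxvec_indexP: i => i1 i2; case/mxvec_indexP => j1 j2.
rewrite mxE /= vec_mx_delta mxvecE.
have s0 : mxsize 0 (delta_mx i1 i2 : 'M[{poly C}]_r).
  by move=> i j; rewrite mxE; case: (_ && _); rewrite ?size_poly1 ?size_poly0.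
by have := mxsizeM s0 sf; apply.
Qed.

Lemma mxsize_lin_mulmx r d (g : 'M_r) : mxsize d g -> mxsize d (lin_mulmx g : 'M_(r * r)).
Proof.
move=> sg i; case/mxvec_indexP: i => i1 i2; case/mxvec_indexP => j1 j2.
rewrite mxE /= vec_mx_delta mxvecE.
have s0 : mxsize 0 (delta_mx i1 i2 : 'M[{poly C}]_r).
  by move=> i j; rewrite mxE; case: (_ && _); rewrite ?size_poly1 ?size_poly0.
by have := mxsizeM sg s0; rewrite addn0; apply.
Qed.

Lemma size_det m d (M : 'M_m) : mxsize d M -> (size (\det M) <= (m * d).+1)%N.
Proof.
move=> sM; apply: size_sum_leq => s _; rewrite -[X in (_ <= X.+1)%N]add0n; apply: size_addM.
  by case: (perm.odd_perm s); rewrite ?expr1 ?expr0 ?size_polyN size_poly1.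
suff h : forall k (F : 'I_k -> {poly C}), (forall i, (size (F i) <= d.+1)%N) ->
   (size (\prod_(i < k) F i)%R <= (k * d).+1)%N by apply: h.
elim=> [|k IH] F h; first by rewrite big_ord0 size_poly1.
by rewrite big_ord_recl mulSn; apply: size_addM => //; apply: IH.
Qed.

Lemma mxsize_mxev m df dg W (A B : 'M_m) (H : {poly {poly {poly C}}}) :
  mxsize df A -> mxsize dg B ->
  (forall i j, H`_j`_i != 0 -> (size (H`_j`_i)%R + i * df + j * dg <= W.+1)%N) ->
  mxsize W (mxev idfun A B H).
Proof.
move=> sA sB sH; apply: mxsize_sum => j _; apply: mxsize_sum => i _.
have [->|c0] := eqVneq H`_j`_i 0; first by rewrite scale0r => k l; rewrite mxE size_poly0.
move=> k l; rewrite mxE; have := sH _ _ c0; have := c0; rewrite -size_poly_gt0.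
have sAB := mxsizeM (mxsizeX i sA) (mxsizeX j sB) k l.
case E: (size H`_j`_i) => [//|s] _ le; apply: leq_trans (_ : (s + (i * df + j * dg)).+1 <= _)%N.
  by apply: size_addM; rewrite // E.
by rewrite addnA -!addSn.
Qed.
End EntrySizes.

(** * Weighted degree and removal of constant roots *)

Section WeightedDegree.
Variables (C : fieldType) (k : nat).
Implicit Types (d e : nat) (p q : {poly {poly C}}).

(** The outer variable has weight [k]. The subtraction is truncated, so coefficients with
    [i * k > d] are zero. *)
Definition wdeg_le d p := forall i, (size (p`_i)%R <= d.+1 - i * k)%N.

Lemma wdeg_leM d e p q : wdeg_le d p -> wdeg_le e q -> wdeg_le (d + e) (p * q).
Proof.
move=> dp eq' l; rewrite coefM; apply: size_sum_leq => -[i /= il] _.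
have [->|p0] := eqVneq p`_i 0; first by rewrite mul0r size_poly0.
have [->|q0] := eqVneq q`_(l - i) 0; first by rewrite mulr0 size_poly0.
have := dp i; have := eq' (l - i)%N; rewrite size_mul // .
move: p0 q0; rewrite -!size_poly_gt0; move: (size _) (size _) => a b a0 b0 bb aa.
have {}il : (i * k + (l - i) * k = l * k)%N by rewrite -mulnDl subnKC.
move: il aa bb; move: (i * k)%N ((l - i) * k)%N (l * k)%N => x y z; clear -a0 b0; lia.
Qed.

Lemma wdeg_le_sum d (I : Type) (s : seq I) (P : pred I) (F : I -> {poly {poly C}}) :
  (forall i, P i -> wdeg_le d (F i)) -> wdeg_le d (\sum_(i <- s | P i) F i).
Proof. by move=> h i; rewrite coef_sum; apply: size_sum_leq => j /h. Qed.

Lemma wdeg_leC d (c : {poly C}) : (size c <= d.+1)%N -> wdeg_le d c%:P.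
Proof. by move=> sc [|i]; rewrite coefC ?subn0 //= size_poly0. Qed.

Lemma wdeg_le1 : wdeg_le 0 1.
Proof. by apply: wdeg_leC; rewrite size_poly1. Qed.

Lemma wdeg_le_prod d m (F : 'I_m -> {poly {poly C}}) : (forall i, wdeg_le d (F i)) ->
   wdeg_le (m * d) (\prod_(i < m) F i).
Proof.
elim: m F => [|m IH] F h; first by rewrite big_ord0; apply: wdeg_le1.
by rewrite big_ord_recl mulSn; apply: wdeg_leM => //; apply: IH.
Qed.

Lemma wdeg_le_char_poly m (M : 'M[{poly C}]_m) : mxsize k M -> wdeg_le (m * k) (char_poly M).
Proof.
move=> sM; apply: wdeg_le_sum => s _; rewrite -[X in wdeg_le X]add0n; apply: wdeg_leM.
  case: (perm.odd_perm s); rewrite ?expr1 ?expr0; last exact: wdeg_le1.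
  by rewrite -polyCN; apply: wdeg_leC; rewrite size_polyN size_poly1.
apply: wdeg_le_prod => i [|[|j]]; rewrite !mxE coefB coefMn coefX coefC /=.
- by rewrite mul0rn sub0r size_polyN subn0.
- by rewrite subr0 mul1n subSnn; case: (_ == _); rewrite ?size_poly0 ?size_poly1.
- by rewrite mul0rn subr0 size_poly0.
Qed.

(** The bound is the weight of the leading power of the outer variable, so the leading coefficient
    is constant. The characteristic polynomial of a matrix with entries of degree at most [k] is of
    this kind. *)
Definition wdeg_tight p := wdeg_le ((size p).-1 * k) p.

(** The coefficients of the quotient satisfy q_i = p_(i+1) + c q_(i+1), and the bound descends from
    the top coefficient. *)
Lemma wdeg_tight_XsubC p q (c : C) : p = ('X - c%:P%:P) * q -> q != 0 ->
  wdeg_tight p -> wdeg_tight q.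
Proof.
move=> Ep q0; have X0 : 'X - c%:P%:P != 0 :> {poly {poly C}} by rewrite polyXsubC_eq0.
have sp : size p = (size q).+1 by rewrite Ep size_mul // size_XsubC.
rewrite /wdeg_tight sp /= => dp i; have [n le] := ubnP (size q - i).
elim: n i le => // n IH i le.
have [lt|ge] := ltnP i (size q); last by rewrite nth_default ?size_poly0.
have Eq : q`_i = p`_i.+1 + c *: q`_i.+1.
  by rewrite Ep mulrBl coefB coefXM coefCM /= mul_polyC subrK.
rewrite Eq; apply: leq_trans (size_polyD _ _) _; rewrite geq_max; apply/andP; split.
  apply: leq_trans (dp _) _; rewrite mulSn; have : (0 < size q)%N by rewrite size_poly_gt0.
  case: (size q) => // s _; rewrite mulSn /=.
  by rewrite -addnS subnDl.
apply: leq_trans (size_scale_leq _ _) _; apply: leq_trans (IH _ _) _;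
  first by move: le lt; clear; lia.
by rewrite mulSn leq_sub2l // leq_addl.
Qed.

Lemma strip_const_roots p : p != 0 -> wdeg_tight p ->
  exists (e : {poly C}) (q : {poly {poly C}}),
   [/\ p = map_poly polyC e * q, e != 0 /\ q != 0,
       (size p).-1 = ((size e).-1 + (size q).-1)%N,
       forall c : C, ~~ root q c%:P & wdeg_tight q].
Proof.
have [n le] := ubnP (size p); elim: n p le => // n IH p le p0 wp.
have [[c rc]|nc] := pselect (exists c : C, root p c%:P); last first.
  exists 1, p; split=> //; first by rewrite rmorph1 mul1r.
  - by rewrite oner_neq0.
  - by rewrite size_poly1.
  - by move=> c; apply/negP => rc; apply: nc; exists c.
have /factor_theorem[q] := rc; rewrite mulrC => Ep.
have q0 : q != 0 by apply: contraNneq p0 => E; rewrite Ep E mulr0.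
have X0 : 'X - c%:P%:P != 0 :> {poly {poly C}} by rewrite polyXsubC_eq0.
have sp : size p = (size q).+1 by rewrite Ep size_mul // size_XsubC.
have [||e [q' [Eq [e0 q'0] sz nr wq']]] := IH q _ q0; first by rewrite -ltnS -sp.
  exact: wdeg_tight_XsubC Ep q0 wp.
have Xc0 : 'X - c%:P != 0 :> {poly C} by rewrite polyXsubC_eq0.
exists (('X - c%:P) * e), q'; split=> //.
- by rewrite Ep Eq rmorphM rmorphB /= map_polyX map_polyC mulrA.
- by rewrite mulf_neq0.
- rewrite sp size_mul // size_XsubC; move: sz.
  have := e0; have := q0; rewrite -!size_poly_gt0.
  by move: (size q) (size e) (size q') => x y z; clear; lia.
Qed.

End WeightedDegree.

(** * Values of x at which the eigenvalues are torsion *)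

Definition const_lift (C : fieldType) (H : {poly {poly C}}) : {poly {poly {poly C}}} :=
  map_poly (map_poly polyC) H.

Lemma coef_const_lift (C : fieldType) (H : {poly {poly C}}) i j :
  (const_lift H)`_j`_i = (H`_j`_i)%:P.
Proof. by rewrite coef_map /= coef_map. Qed.

Lemma ev_lift (C : fieldType) (L : comNzRingType) (psi : {rmorphism {poly C} -> L})
    (io : {rmorphism C -> L}) a b H :
  psi \o polyC =1 io -> ev psi a b (const_lift H) = ev io a b H.
Proof.
move=> E; have s1 : (size (const_lift H) <= size H)%N by apply: size_poly.
have s2 : (sizeY (const_lift H) <= sizeY H)%N.
  apply/sizeY_le => i j; rewrite coef_const_lift polyC_eq0.
  case: ltnP => // le; rewrite (nth_default 0) ?eqxx //.
  exact: leq_trans (max_size_coefXY _ _) le.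
rewrite (evE psi a b s1 s2) (evE _ _ _ (leqnn _) (leqnn _)).
apply: eq_bigr => j _; apply: eq_bigr => i _; rewrite coef_const_lift.
by rewrite -E.
Qed.

Lemma map_horner_polyC (C : fieldType) (x : C) (e : {poly C}) :
  map_poly (horner_eval x \o polyC) e = e.
Proof. by apply/polyP => i; rewrite coef_map /= /horner_eval hornerC. Qed.

Section SpecialValues.
Variables (C : numClosedFieldType) (K : closedFieldType) (phi : {rmorphism {poly C} -> K}).
Hypothesis phi_inj : injective phi.
Local Notation iota := (phi \o polyC : {rmorphism C -> K}).
Implicit Types (P H F : {poly {poly C}}).

Lemma ev_const_lift a b H : ev phi a b (const_lift H) = ev iota a b H.
Proof. exact: ev_lift. Qed.

Lemma ev_horner_const_lift (x a b : C) H :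
  ev (horner_eval x) a b (const_lift H) = evc (a, b) H.
Proof. by apply: ev_lift => c; rewrite /= /horner_eval hornerC. Qed.

Variables (r df dg : nat) (fx gx : 'M[{poly C}]_r).
Hypotheses (r_gt0 : (0 < r)%N) (sfx : mxsize df fx) (sgx : mxsize dg gx).
Hypothesis indep : forall h1 h2, eigenvalue (map_mx phi fx) h1 ->
  eigenvalue (map_mx phi gx) h2 -> mult_indep h1 h2.

Definition nonconst_pair (h : K * K) :=
  [/\ eigenvalue (map_mx phi fx) h.1, eigenvalue (map_mx phi gx) h.2 & nonconst iota h.1].

Definition special_at (x : C) (u : C * C) :=
  [/\ eigenvalue (map_mx (horner_eval x) fx) u.1, eigenvalue (map_mx (horner_eval x) gx) u.2 &
      exists2 m, (0 < m)%N & u.1 ^+ m = 1 /\ u.2 ^+ m = 1].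

Lemma closed_eigenvalue (M : 'M[K]_r) : exists a, eigenvalue M a.
Proof.
have [a] : exists a, root (char_poly M) a.
  by apply/closed_rootP; rewrite size_char_poly eqSS -lt0n.
by rewrite -eigenvalue_root_char; exists a.
Qed.

Lemma const_eigenvalue (e : {poly C}) (q : {poly {poly C}}) c :
  char_poly fx = map_poly polyC e * q -> root e c -> eigenvalue (map_mx phi fx) (iota c).
Proof.
move=> E rc; rewrite eigenvalue_root_char -map_char_poly E rmorphM /= rootM -map_poly_comp.
by rewrite fmorph_root rc.
Qed.

(** Since g(xI) has an eigenvalue in [K], a relation with exponents (m, 0) contradicts
    independence. *)
Lemma const_not_torsion c m : eigenvalue (map_mx phi fx) (iota c) -> (0 < m)%N -> c ^+ m != 1.
Proof.
move=> ec m0; apply/eqP => cm; have [b eb] := closed_eigenvalue (map_mx phi gx).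
have /(_ m%:Z 0) := indep ec eb; rewrite expr0z mulr1 -exprnP -rmorphXn cm rmorph1.
by case=> // /eqP; rewrite eqz_nat gtn_eqF.
Qed.

(* [e] collects the constant eigenvalues of f(xI). *)
Lemma splitting_char_poly : exists (e : {poly C}) (q : {poly {poly C}}),
  [/\ forall h1, eigenvalue (map_mx phi fx) h1 ->
        (map_poly iota e).[h1] = 0 \/ (map_poly phi q).[h1] = 0 /\ nonconst iota h1,
      forall c, ~~ root q c%:P,
      forall h1, (map_poly iota e).[h1] = 0 -> ~ nonconst iota h1,
      forall x u, special_at x u ->
        e.[u.1] != 0 /\ (map_poly (horner_eval x) q).[u.1] = 0 &
      exists2 k, (k <= r)%N & (size e <= k.+1)%N /\ wdeg_le df ((r - k) * df) q].
Proof.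
have wc : wdeg_tight df (char_poly fx).
  by rewrite /wdeg_tight size_char_poly; apply: wdeg_le_char_poly.
have [e [q [Eq [e0 q0] sz nr wq]]] :=
  strip_const_roots (monic_neq0 (char_poly_monic fx)) wc.
have nco h1 : (map_poly phi q).[h1] = 0 -> nonconst iota h1.
  move=> qh c; apply/eqP => Ec; have := nr c; rewrite /root => /eqP[].
  by apply: phi_inj; rewrite rmorph0 -horner_map /= -[phi _]/(iota c) Ec.
exists e, q; split=> //.
- move=> h1; rewrite eigenvalue_root_char -map_char_poly Eq rmorphM /= rootM -map_poly_comp.
  by case/orP => /eqP h; [left | right; split=> //; apply: nco].
- move=> h1 eh nc; have [c Ec] : exists c, h1 = iota c by apply: (alg_const e0); apply/eqP.
  by have := nc c; rewrite Ec eqxx.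
- move=> x u [efu _ [m m0 [um _]]].
  have eu : e.[u.1] != 0.
    apply/negP => /const_eigenvalue-/(_ _ Eq) /const_not_torsion /(_ m0).
    by rewrite um eqxx.
  split=> //; move: efu; rewrite eigenvalue_root_char -map_char_poly Eq rmorphM /= rootM.
  rewrite -map_poly_comp map_horner_polyC.
  by rewrite /root (negPf eu) => /eqP.
- exists (size e).-1; last first.
    split; first exact: leqSpred.
    by rewrite /wdeg_tight in wq; move: sz; rewrite size_char_poly /= => ->; rewrite addKn.
  by move: sz; rewrite size_char_poly /= => ->; apply: leq_addr.
Qed.

Let A : 'M_(r * r) := lin_mulmxr fx.
Let B : 'M_(r * r) := lin_mulmx gx^T.

Lemma eigenvalue_lin_mxev (H : {poly {poly {poly C}}}) z :
  eigenvalue (map_mx phi (mxev idfun A B H)) z ->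
  exists h1 h2, [/\ eigenvalue (map_mx phi fx) h1, eigenvalue (map_mx phi gx) h2 &
     z = ev phi h1 h2 H].
Proof.
rewrite map_mxev map_lin_mulmxr map_lin_mulmx -map_trmx.
case/eigenvalue_mxev; first exact: lin_mul_comm.
move=> h1 [h2 [e1 e2 ->]]; exists h1, h2; split=> //.
  exact: eigenvalue_lin_mulmxr e1.
exact: eigenvalue_lin_mulmx e2.
Qed.

Lemma special_eigenvalue x u (H : {poly {poly {poly C}}}) : special_at x u ->
  eigenvalue (map_mx (horner_eval x) (mxev idfun A B H)) (ev (horner_eval x) u.1 u.2 H).
Proof.
case=> e1 e2 _; rewrite map_mxev map_lin_mulmxr map_lin_mulmx -map_trmx.
have [v [v0 vA vB]] := lin_mul_eigenvector e1 e2.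
by apply/eigenvalueP; exists v => //; apply: mxev_eigen.
Qed.

(** The operator attached to [e * P] has only the eigenvalue 0 over [K]: [e] vanishes at the
    constant eigenvalues of f(xI) and [P] at the other pairs. So its characteristic polynomial is a
    power of the variable, also after specialization at [x], where e(u.1) P(u) is an eigenvalue. As
    u.1 is a root of unity, e(u.1) is nonzero. *)
Lemma special_zero P x u : (forall h, nonconst_pair h -> evp iota h P = 0) ->
  special_at x u -> evc u P = 0.
Proof.
move=> Pz sp; have [e [q [splitf _ _ spq _]]] := splitting_char_poly.
have [eu _] := spq _ _ sp.
pose H : {poly {poly {poly C}}} := (map_poly polyC e)%:P * const_lift P.
pose M := mxev idfun A B H.
have EM : char_poly M = 'X^(r * r).
  apply: (map_inj_poly phi_inj (rmorph0 _)); rewrite map_polyXn map_char_poly.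
  have [rs Ers] := closed_field_poly_normal (char_poly (map_mx phi M)).
  have := Ers; rewrite (monicP (char_poly_monic _)) scale1r => {}Ers.
  have sz : size rs = (r * r)%N.
    by apply: succn_inj; rewrite -(size_prod_XsubC rs id) -Ers size_char_poly.
  have -> : 'X^(r * r) = \prod_(z <- rs) 'X :> {poly K}.
    by rewrite big_const_seq count_predT iter_mulr_1 sz.
  rewrite Ers big_seq [RHS]big_seq; apply: eq_bigr => z zrs; rewrite (_ : z = 0) ?subr0 //.
  have : eigenvalue (map_mx phi M) z.
    by rewrite eigenvalue_root_char Ers root_prod_XsubC.
  case/eigenvalue_lin_mxev => h1 [h2 [e1 e2 ->]]; rewrite evM evC ev_const_lift.
  rewrite -map_poly_comp; have [->|[_ nc]] := splitf _ e1; first by rewrite mul0r.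
  by rewrite (Pz (h1, h2)) ?mulr0.
have := special_eigenvalue H sp; rewrite -/M eigenvalue_root_char -map_char_poly EM.
rewrite map_polyXn /root hornerXn expf_eq0 muln_gt0 r_gt0 /= evM evC.
rewrite ev_horner_const_lift -map_poly_comp map_horner_polyC.
by rewrite mulf_eq0 (negPf eu) => /eqP; case: (u).
Qed.

Lemma eigenvalue0 (F : fieldType) m (M : 'M[F]_m) : eigenvalue M 0 = (\det M == 0).
Proof.
apply/eigenvalueP/det0P => [[v vM v0]|[v v0 vM]]; exists v => //.
  by rewrite vM scale0r.
by rewrite vM scale0r.
Qed.

(* The operator is taken for [e * H + q]: the summand [q] makes it invertible at the
   constant eigenvalues of f(xI), where nothing is known about [H], and it vanishes
   at the others. *)
Lemma special_vanishing H a b :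
  bideg_le a b H -> (forall h, nonconst_pair h -> evp iota h H != 0) ->
  exists D : {poly C}, [/\ D != 0, (size D <= (r * r * ((r + b) * df + a * dg)).+1)%N &
    forall x u, special_at x u -> evc u H = 0 -> root D x].
Proof.
move=> [sH yH] Hz; have [e [q [splitf nr enc spq [k kr [se wq]]]]] := splitting_char_poly.
pose Hw : {poly {poly {poly C}}} := (map_poly polyC e)%:P * const_lift H + q%:P.
have evHw (T : fieldType) (io : {rmorphism {poly C} -> T}) x y : ev io x y Hw =
    (map_poly (io \o polyC) e).[x] * ev io x y (const_lift H) + (map_poly io q).[x].
  by rewrite rmorphD /= evM !evC -map_poly_comp.
exists (\det (mxev idfun A B Hw)); split.
- apply/negP => /eqP D0.
  have : eigenvalue (map_mx phi (mxev idfun A B Hw)) 0.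
    by rewrite eigenvalue0 det_map_mx D0 rmorph0.
  case/eigenvalue_lin_mxev => h1 [h2 [e1 e2]]; rewrite evHw ev_const_lift => /esym/eqP.
  have [eh|[qh nc]] := splitf _ e1.
    rewrite eh mul0r add0r => /eqP qh.
    have [c Ec] : exists c, h1 = iota c.
      apply: contrapT => ne; apply: (enc _ eh) => c; apply/eqP => Ec.
      by apply: ne; exists c.
    have /negP[] := nr c; apply/eqP/phi_inj; rewrite rmorph0 -horner_map /= -[phi _]/(iota c).
    by rewrite -Ec.
  rewrite qh addr0 mulf_eq0 => /orP[/eqP eh|]; first exact: (enc _ eh).
  by apply/negP; apply: (Hz (h1, h2)).
- apply: size_det; apply: mxsize_mxev (mxsize_lin_mulmxr sfx) (mxsize_lin_mulmx _) _.
    by move=> i j; rewrite mxE.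
  move=> i j; rewrite coefD coefCM coefD coef_map /= -rmorphM coef_map coefC /=.
  (* The product of [e] and [H] has degree at most r + b in the variable for f and a in that for g;
     the weighted degree of [q] is at most (r - k) df. *)
  set W := ((r + b) * df + a * dg)%N.
  have b1 : (e * H`_j)`_i != 0 -> (1 + i * df + j * dg <= W.+1)%N.
    move=> c0; have jl : (j <= a)%N.
      rewrite -ltnS; apply: leq_trans sH; rewrite ltnNge; apply/negP => le.
      by move: c0; rewrite (nth_default 0 le) mulr0 coef0 eqxx.
    have il : (i <= r + b)%N.
      have sj := leq_trans (max_size_coefXY H j) yH.
      rewrite -ltnS; apply: leq_trans (_ : (k + b).+1 <= _)%N; last by rewrite ltnS leq_add2r.
      apply: leq_trans (size_addM se sj); rewrite ltnNge; apply/negP => le.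
      by move: c0; rewrite (nth_default 0 le) eqxx.
    by rewrite -addnA add1n ltnS leq_add // leq_mul.
  have b2 : q`_i != 0 -> (size (q`_i)%R + i * df <= W.+1)%N.
    have := wq i; rewrite -size_poly_gt0; have : ((r - k) * df <= W)%N.
      rewrite /W -[X in (X <= _)%N]addn0 leq_add // leq_mul2r.
      by rewrite (leq_trans (leq_subr _ _)) ?leq_addr ?orbT.
    by move: (size _) (_ * df)%N (i * df)%N => s t l; clear; lia.
  have sc (c : C) : (size c%:P <= 1)%N by rewrite size_polyC; case: (c != 0).
  have [j0|_] := eqVneq j 0%N; last first.
    by rewrite coef0 addr0 polyC_eq0 => c0; rewrite size_polyC c0 b1.
  have [->|c0] := eqVneq (e * H`_j)`_i 0; first by rewrite add0r j0 mul0n addn0; apply: b2.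
  rewrite j0 mul0n addn0 => _; have {b1} := b1 c0; rewrite j0 mul0n addn0 => b1.
  apply: leq_trans (_ : maxn (size ((e * H`_0)`_i)%:P) (size q`_i)%R + i * df <= _)%N.
    by rewrite leq_add2r size_polyD.
  rewrite addn_maxl geq_max; apply/andP; split; first by rewrite (leq_trans _ b1) ?leq_add2r.
  by have [->|/b2 //] := eqVneq q`_i 0; rewrite size_poly0 (leq_trans _ b1) ?leq_add2r.
- move=> x u sp uH; have [eu qu] := spq _ _ sp.
  have := special_eigenvalue Hw sp; rewrite evHw ev_horner_const_lift qu addr0.
  rewrite -surjective_pairing uH mulr0 eigenvalue0 det_map_mx.
  by rewrite /root.
Qed.

End SpecialValues.

(** * A polynomial vanishing at all pairs of eigenvalues *)

Lemma kernel_row (F : fieldType) (S Q : finType) (M : S -> Q -> F) : (#|Q| < #|S|)%N ->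
  exists c : S -> F, (exists s, c s != 0) /\ forall q, \sum_s c s * M s q = 0.
Proof.
move=> lt; pose A := \matrix_(i < #|S|, j < #|Q|) M (enum_val i) (enum_val j).
have /rowV0Pn[v /sub_kermxP vA /rV0Pn[i vi]] : kermx A != 0.
  rewrite kermx_eq0; apply/negP => /eqP rA; have := rank_leq_col A.
  by rewrite rA leqNgt lt.
exists (fun s => v 0 (enum_rank s)); split; first by exists (enum_val i); rewrite enum_valK.
move=> q; transitivity ((v *m A) 0 (enum_rank q)); last by rewrite vA mxE.
rewrite mxE.
rewrite (reindex (fun i : 'I_#|S| => enum_val i)) /=; last exact/onW_bij/enum_val_bij.
by apply: eq_bigr => j _; rewrite enum_valK mxE !enum_rankK.
Qed.

(** The exponents i r + j are pairwise distinct, so for nonzero u and w the scalar u X w is a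
    nonzero polynomial in [t]. A suitable [t] in C therefore makes it nonzero for finitely many
    given pairs at once. *)
Definition moment_mx (C : nzRingType) (r : nat) (t : C) : 'M[C]_r :=
  \matrix_(i, j) t ^+ (i * r + j).

Section Annihilator.
Variables (C : numClosedFieldType) (K : closedFieldType) (phi : {rmorphism {poly C} -> K}).
Local Notation iota := (phi \o polyC : {rmorphism C -> K}).
Variables (r df dg : nat) (fx gx : 'M[{poly C}]_r).
Hypotheses (df_gt0 : (0 < df)%N) (dg_gt0 : (0 < dg)%N) (r_gt0 : (0 < r)%N).
Hypotheses (sfx : mxsize df fx) (sgx : mxsize dg gx).

Lemma bilinear_moment_neq0 (u : 'rV[K]_r) (w : 'cV[K]_r) : u != 0 -> w != 0 ->
  exists2 p : {poly K}, p != 0 & forall t, (u *m moment_mx r t *m w) 0 0 = p.[t].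
Proof.
move=> /rV0Pn[i0 ui] /cV0Pn[j0 wj].
exists (\sum_i \sum_j (u 0 i * w j 0) *: 'X^(i * r + j)).
  apply/negP => /eqP /polyP /(_ (i0 * r + j0)%N); rewrite coef0 coef_sum (bigD1 i0) //=.
  rewrite coef_sum (bigD1 j0) //= coefZ coefXn eqxx mulr1 big1 => [|j nj]; last first.
    by rewrite coefZ coefXn eqn_add2l eq_sym (inj_eq val_inj) (negPf nj) mulr0.
  rewrite addr0 big1 ?addr0 => [/eqP|i ni].
    by rewrite mulf_eq0 (negPf ui) (negPf wj).
  rewrite coef_sum big1 // => j _; rewrite coefZ coefXn; case: eqP => [E|]; last by rewrite mulr0.
  have := congr1 (fun x => x %/ r)%N E; rewrite !divnMDl // !divn_small // !addn0 => Ei.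
  by case/eqP: ni; apply/val_inj.
move=> t; rewrite mxE horner_sum.
under [RHS]eq_bigr do rewrite horner_sum.
rewrite exchange_big; apply: eq_bigr => j _; rewrite mxE mulr_suml; apply: eq_bigr => i _.
by rewrite mxE hornerZ hornerXn mulrAC.
Qed.

Lemma eigenvalue_col (M : 'M[K]_r) a : eigenvalue M a ->
  exists2 w : 'cV_r, M *m w = a *: w & w != 0.
Proof.
have -> : eigenvalue M a = eigenvalue M^T a.
  rewrite !eigenvalue_root_char /char_poly -det_tr; congr (root (\det _) a).
  by apply/matrixP => i j; rewrite !mxE eq_sym.
case/eigenvalueP => v vM v0; exists v^T; last by rewrite trmx_eq0.
by rewrite -[M]trmxK -trmx_mul vM linearZ.
Qed.

Lemma generic_value (p : {poly K}) : p != 0 -> exists t : C, p.[iota t] != 0.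
Proof.
move=> p0; apply: contrapT => ne.
have := @max_poly_roots _ p [seq iota i%:R | i <- seq.iota 0 (size p)] p0.
rewrite size_map size_iota ltnn => h; suff : false by []; apply: h.
  apply/allP => x /mapP[i _ ->]; apply: contraT => nr; case: ne; by exists i%:R.
rewrite map_inj_uniq ?iota_uniq // => i j /fmorph_inj /eqP.
by rewrite eqr_nat => /eqP.
Qed.

Lemma eigenvalue_seq (M : 'M[K]_r) : exists s : seq K, forall a, eigenvalue M a = (a \in s).
Proof.
have [rs Ers] := closed_field_poly_normal (char_poly M); exists rs => a.
by rewrite eigenvalue_root_char Ers (monicP (char_poly_monic _)) scale1r root_prod_XsubC.
Qed.

Lemma separating_moment (L : seq (K * K)) :
  (forall h, h \in L -> eigenvalue (map_mx phi fx) h.1 /\ eigenvalue (map_mx phi gx) h.2) ->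
  exists t : C, forall h, h \in L -> exists (u : 'rV_r) (w : 'cV_r),
    [/\ u *m map_mx phi fx = h.1 *: u, map_mx phi gx *m w = h.2 *: w &
        (u *m moment_mx r (iota t) *m w) 0 0 != 0].
Proof.
move=> eL; have [p p0 pL] : exists2 p : {poly K}, p != 0 &
    forall t, p.[t] != 0 -> forall h, h \in L -> exists (u : 'rV_r) (w : 'cV_r),
    [/\ u *m map_mx phi fx = h.1 *: u, map_mx phi gx *m w = h.2 *: w &
        (u *m moment_mx r t *m w) 0 0 != 0].
  elim: L eL => [|h L IH] eL; first by exists 1; rewrite ?oner_neq0.
  have [|p p0 pL] := IH; first by move=> k kL; apply: eL; rewrite inE kL orbT.
  have [/eigenvalueP[u uf u0] /eigenvalue_col[w gw w0]] := eL _ (mem_head _ _).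
  have [q q0 qE] := bilinear_moment_neq0 u0 w0.
  exists (q * p); rewrite ?mulf_neq0 // => t; rewrite hornerM mulf_eq0 negb_or => /andP[qt pt] k.
  rewrite inE => /predU1P[->|kL]; last exact: pL.
  by exists u, w; rewrite qE.
by have [t pt] := generic_value p0; exists t; apply: pL.
Qed.

Lemma mulmx_eigenXr (M : 'M[K]_r) (w : 'cV_r) b j : M *m w = b *: w -> M ^+ j *m w = b ^+ j *: w.
Proof.
move=> Mw; elim: j => [|j IH]; first by rewrite !expr0 mul1mx scale1r.
by rewrite exprSr -[_ * M]/(_ *m M) -mulmxA Mw -scalemxAr IH scalerA exprS.
Qed.

(** The (a + 1)(b + 1) products f^i X g^j have r^2 entries of degree at most d = 4 r^2 df dg. They
    satisfy a linear relation over C, because (a + 1)(b + 1) > r^2 (d + 1). Between a left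
    eigenvector u of f(xI) and a right eigenvector w of g(xI) the relation becomes F(h) times u X w,
    where the constant matrix X makes u X w nonzero. *)
Lemma annihilator (L : seq (K * K)) :
  (forall h, h \in L -> eigenvalue (map_mx phi fx) h.1 /\ eigenvalue (map_mx phi gx) h.2) ->
  exists F : {poly {poly C}}, [/\ F != 0,
    bideg_le (2 * (r * r) * df) (2 * (r * r) * dg) F &
    forall h, h \in L -> evp iota h F = 0].
Proof.
move=> /separating_moment[t tL].
pose a := (2 * (r * r) * df)%N; pose b := (2 * (r * r) * dg)%N.
pose d := (b * df + a * dg)%N.
pose S : finType := ('I_a.+1 * 'I_b.+1)%type.
pose Q : finType := ('I_r * 'I_r * 'I_d.+1)%type.
pose X : 'M[{poly C}]_r := map_mx polyC (moment_mx r t).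
pose E (s : S) := fx ^+ s.2 *m X *m gx ^+ s.1.
have sE s : mxsize d (E s).
  have sX : mxsize 0 X by move=> i j; rewrite mxE size_polyC; case: (_ != 0).
  have sz := mxsizeM (mxsizeM (mxsizeX s.2 sfx) sX) (mxsizeX s.1 sgx).
  move=> i j; apply: leq_trans (sz i j) _; rewrite ltnS addn0 /d.
  by rewrite leq_add // leq_mul2r -ltnS ltn_ord orbT.
have [|c [[s0 cs0] cE]] := @kernel_row C S Q (fun s q => (E s q.1.1 q.1.2)`_q.2).
  rewrite !card_prod !card_ord.
  have r2 : (0 < r * r)%N by rewrite muln_gt0 r_gt0.
  rewrite /d /a /b; move: r2; move: (r * r)%N => x x0; nia.
have cE0 : \sum_s (c s)%:P *: E s = 0.
  apply/matrixP => i j; apply/polyP => k; rewrite summxE mxE coef0 coef_sum.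
  under eq_bigr do rewrite mxE coefCM.
  have [kd|kd] := leqP k d; first exact: (cE ((i, j), Ordinal (kd : k < d.+1)%N)).
  by rewrite big1 // => s _; rewrite (nth_default 0) ?mulr0 // (leq_trans (sE s i j)).
pose F : {poly {poly C}} := \poly_(j < a.+1) \poly_(i < b.+1) c (inord j, inord i).
have FE (s : S) : F`_s.1`_s.2 = c s.
  by rewrite !coef_poly !ltn_ord coef_poly ltn_ord !inord_val; case: s.
have bF : bideg_le a b F.
  split; first exact: size_poly.
  apply/sizeY_le => i j; rewrite coef_poly; case: ifP => _; last by rewrite coef0 eqxx.
  by rewrite coef_poly; case: ltnP => //; rewrite eqxx.
exists F; split=> //.
  by apply: contraNneq cs0 => F0; rewrite -FE F0 !coef0.
move=> h /tL[u [w [uf gw uw]]]; have [sF yF] := bF.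
rewrite (evE _ _ _ sF yF) pair_big.
have := congr1 (fun M => (u *m map_mx phi M *m w) 0 0) cE0.
rewrite map_mx0 mulmx0 mul0mx [in RHS]mxE rmorph_sum mulmx_sumr mulmx_suml summxE.
have -> : \sum_s (u *m map_mx phi ((c s)%:P *: E s) *m w) 0 0 =
    (\sum_(s : S) iota F`_s.1`_s.2 * h.1 ^+ s.2 * h.2 ^+ s.1) * (u *m moment_mx r (iota t) *m w) 0 0.
  rewrite mulr_suml; apply: eq_bigr => s _; rewrite FE map_mxZ /E !map_mxM !rmorphXn /=.
  have -> : map_mx phi X = moment_mx r (iota t).
    by apply/matrixP => i j; rewrite !mxE /= !rmorphXn.
  rewrite -scalemxAr !mulmxA (mulmx_eigenX _ uf) -!scalemxAl -!mulmxA (mulmx_eigenXr _ gw).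
  by rewrite -!scalemxAr !scalerA mxE.
by move/eqP; rewrite mulf_eq0 (negPf uw) orbF => /eqP.
Qed.

End Annihilator.

(** * Counting the special values *)

(** A common order of torsion points is available only for finitely many of them at a time; a bound
    uniform over finite lists then gives finiteness of the whole set. *)
Lemma finite_of_bounded (T : eqType) (P : T -> Prop) N :
  (forall X : seq T, uniq X -> (forall x, x \in X -> P x) -> (size X <= N)%N) ->
  exists2 X : seq T, (size X <= N)%N & forall x, P x -> x \in X.
Proof.
move=> bnd; pose has_size k := `[< exists X : seq T,
  [/\ uniq X, forall x, x \in X -> P x & size X = k] >].
have ex0 : exists k, has_size k by exists 0%N; apply/asboolP; exists [::].
have lek k : has_size k -> (k <= N)%N by move=> /asboolP[X [uX PX <-]]; apply: bnd.
case: (ex_maxnP ex0 lek) => k /asboolP[X [uX PX sX]] kmax.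
exists X => [|x Px]; first exact: bnd.
apply: contraT => xX; have : has_size k.+1.
  apply/asboolP; exists (x :: X); split; rewrite /= ?xX ?sX // => y.
  by rewrite inE => /predU1P[->|/PX].
by move/kmax; rewrite ltnn.
Qed.

Section FewSpecialValues.
Variables (C : numClosedFieldType) (K : closedFieldType) (phi : {rmorphism {poly C} -> K}).
Hypothesis phi_inj : injective phi.
Local Notation iota := (phi \o polyC : {rmorphism C -> K}).
Variables (r df dg : nat) (fx gx : 'M[{poly C}]_r).
Hypotheses (df_gt0 : (0 < df)%N) (dg_gt0 : (0 < dg)%N) (r_gt0 : (0 < r)%N).
Hypotheses (sfx : mxsize df fx) (sgx : mxsize dg gx).
Hypothesis indep : forall h1 h2, eigenvalue (map_mx phi fx) h1 ->
  eigenvalue (map_mx phi gx) h2 -> mult_indep h1 h2.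

Lemma special_witnesses (X : seq C) : (forall x, x \in X -> exists u, special_at fx gx x u) ->
  exists (L : seq (C * (C * C))) n, [/\ (0 < n)%N, forall x, x \in X -> exists u, (x, u) \in L &
    forall y, y \in L -> special_at fx gx y.1 y.2 /\ y.2.1 ^+ n = 1 /\ y.2.2 ^+ n = 1].
Proof.
elim: X => [|x X IH] sX; first by exists [::], 1%N.
have [|L [n [n0 XL LP]]] := IH; first by move=> y yX; apply: sX; rewrite inE yX orbT.
have [u su] := sX _ (mem_head _ _); have [_ _ [m m0 [u1 u2]]] := su.
exists ((x, u) :: L), (m * n)%N; split=> [|y|y].
- by rewrite muln_gt0 m0.
- rewrite inE => /predU1P[->|/XL[v vL]]; first by exists u; rewrite mem_head.
  by exists v; rewrite inE vL orbT.
- rewrite inE => /predU1P[->|/LP[sy [y1 y2]]] /=; split=> //.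
    by rewrite !exprM u1 u2 !expr1n.
  by rewrite mulnC !exprM y1 y2 !expr1n.
Qed.

Lemma few_special : exists2 X : seq C, (size X <= 72 * r ^ 4 * (df * dg))%N &
  forall x u, special_at fx gx x u -> x \in X.
Proof.
suff [X sX XP] : exists2 X : seq C, (size X <= 72 * r ^ 4 * (df * dg))%N &
    forall x, (exists u, special_at fx gx x u) -> x \in X.
  by exists X => // x u su; apply: XP; exists u.
apply: finite_of_bounded => X uX /special_witnesses[L [n [n0 XL LP]]].
have [sf sfE] := eigenvalue_seq (map_mx phi fx).
have [sg sgE] := eigenvalue_seq (map_mx phi gx).
pose L0 := [seq (h1, h2) | h1 <- sf, h2 <- sg].
have L0E (h : K * K) : h \in L0 = eigenvalue (map_mx phi fx) h.1 && eigenvalue (map_mx phi gx) h.2.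
  rewrite sfE sgE; apply/allpairsP/andP => [[[x y] /= [? ? ->]] //|[? ?]].
  by exists h; split=> //; apply: surjective_pairing.
pose ps := [seq h <- L0 | `[< nonconst iota h.1 >]].
have psE h : h \in ps <-> nonconst_pair phi fx gx h.
  rewrite mem_filter L0E; split=> [/andP[/asboolP nc /andP[e1 e2]] //|[e1 e2 nc]].
  by rewrite e1 e2 !andbT; apply/asboolP.
have [F [F0 bF FL]] := @annihilator _ _ _ _ _ _ _ _ df_gt0 dg_gt0 r_gt0 sfx sgx L0
  (fun h hL => andP (etrans (esym (L0E h)) hL)).
have psP h : h \in ps -> nonconst iota h.1 /\ mult_indep h.1 h.2.
  by move=> /psE[e1 e2 nc]; split=> //; apply: indep.
have psF h : h \in ps -> evp iota h F = 0 by rewrite mem_filter => /andP[_ /FL].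
have Un u : u \in [seq y.2 | y <- L] -> u.1 ^+ n = 1 /\ u.2 ^+ n = 1.
  by case/mapP => y /LP[_ yn] ->.
have [P [H [Pps Hps Hb HU]]] := global_cover psP F0 bF psF n0 Un.
have bndH i := special_vanishing phi_inj r_gt0 sfx sgx indep (Hb i)
  (fun h hP => Hps i h ((psE h).2 hP)).
have [D DP] := choice bndH.
have D0 : \prod_i D i != 0 by apply/prodf_neq0 => i _; have [] := DP i.
(* The bidegree of each [H i] is at most (4 r^2 df, 4 r^2 dg), so each determinant has degree at
   most r^2 (r df + 8 r^2 df dg) <= 9 r^4 df dg, and there are eight. *)
have szD : (size (\prod_i D i)%R <= (72 * r ^ 4 * (df * dg)).+1)%N.
  rewrite size_prod => [|i _]; last by have [] := DP i.
  rewrite card_ord; apply: leq_trans (_ : (\sum_(i < 8)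
    (r * r * ((r + (2 * (r * r) * dg).*2) * df + (2 * (r * r) * df).*2 * dg)).+1).+1 - 8 <= _)%N.
    by rewrite leq_sub2r // ltnS; apply: leq_sum => i _; have [] := DP i.
  rewrite sum_nat_const card_ord !expnS expn0 muln1.
  have : (r <= r * r)%N by rewrite leq_pmulr.
  have : (df <= df * dg)%N by rewrite leq_pmulr.
  move=> d1 r1; have := leq_mul r1 d1; clear; nia.
rewrite -ltnS; apply: leq_trans szD; apply: max_poly_roots => //.
apply/allP => x /XL[u uL]; have [su _] := LP _ uL.
have Pu := special_zero phi_inj r_gt0 sfx indep (fun h hP => Pps h ((psE h).2 hP)) su.
have [|i Hi] := HU u _ Pu; first by apply/mapP; exists (x, u).
rewrite (bigD1 i) //= rootM; apply/orP; left; have [_ _] := DP i; apply; [exact: su | exact: Hi].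
Qed.

End FewSpecialValues.

(** * Eigenvalues of a commuting matrix *)

Section CommutingMatrix.
Variables (C : numClosedFieldType) (n : nat).
Implicit Types (f g : {poly 'M[C]_n.+1}) (A : 'M[C]_n.+1).

Lemma mxsize_mxpoly_xI f : (1 < size f)%N -> mxsize (mxdeg f) (mxpoly_xI f).
Proof. by move=> sf i j; rewrite mxE (leq_trans (size_poly _ _)) // /mxdeg prednK // ltnW. Qed.

Lemma horner_mxpoly_xI f x :
  map_mx (horner_eval x) (mxpoly_xI f) = \sum_(i < size f) x ^+ i *: f`_i.
Proof.
apply/matrixP => j k; rewrite !mxE /horner_eval horner_poly summxE.
by apply: eq_bigr => i _; rewrite mxE mulrC.
Qed.

Lemma mulmx_mxpoly_eval f A (x : C) (v : 'rV_n.+1) : (forall i, GRing.comm A f`_i) ->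
  v *m A = x *: v -> v *m mxpoly_eval f A = v *m map_mx (horner_eval x) (mxpoly_xI f).
Proof.
move=> Af vA; rewrite horner_mxpoly_xI !mulmx_sumr; apply: eq_bigr => i _.
rewrite -[_ * _]/(_ *m _) mulmxA.
rewrite (@mulmx_eigenX _ _ _ _ x) -?scalemxAr // -mulmxA -[_ *m A]/(_ * A) -Af.
by rewrite -[A * _]/(A *m _) mulmxA vA scalemxAl.
Qed.

(** The eigenvector of f(xI) must be taken inside the eigenspace of [A], where f(A) and f(xI) agree;
    it exists there because [A] commutes with f(xI). *)
Lemma torsion_eigenvalue f A x : (forall i, GRing.comm A f`_i) ->
  torsion_mx (mxpoly_eval f A) -> eigenvalue A x ->
  exists z m, [/\ (0 < m)%N, z ^+ m = 1 & eigenvalue (map_mx (horner_eval x) (mxpoly_xI f)) z].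
Proof.
move=> Af [m [m0 fm]] Ex; set fx := map_mx _ _.
have Afx : GRing.comm A fx.
  rewrite /fx horner_mxpoly_xI; apply: commr_sum => i _.
  rewrite /GRing.comm -scalerAr -scalerAl; congr (_ *: _); exact: Af.
have st : stablemx (eigenspace A x) fx.
  apply/eigenspaceP; rewrite -mulmxA -[fx *m A]/(fx * A) -Afx -[A * _]/(A *m _) mulmxA.
  by have /eigenspaceP-> := submx_refl (eigenspace A x); rewrite scalemxAl.
have [z /rowV0Pn[v]] := stable_eigen Ex st.
rewrite sub_capmx => /andP[/eigenspaceP vA /eigenspaceP vf] v0.
exists z, m; split=> //; last by apply/eigenvalueP; exists v.
have := mulmx_mxpoly_eval Af vA; rewrite -/fx vf => /(mulmx_eigenX m).
rewrite fm mulmx1 => /eqP; rewrite -subr_eq0 -{1}[v]scale1r -scalerBl scaler_eq0 (negPf v0) orbF.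
by rewrite subr_eq0 => /eqP.
Qed.

Lemma eigenvalue_special f g A x :
  (forall i, GRing.comm A f`_i) -> (forall i, GRing.comm A g`_i) ->
  torsion_mx (mxpoly_eval f A) -> torsion_mx (mxpoly_eval g A) ->
  eigenvalue A x -> exists u, special_at (mxpoly_xI f) (mxpoly_xI g) x u.
Proof.
move=> Af Ag tf tg Ex.
have [z [m [m0 zm ez]]] := torsion_eigenvalue Af tf Ex.
have [w [k [k0 wk ew]]] := torsion_eigenvalue Ag tg Ex.
exists (z, w); split=> //; exists (m * k)%N; first by rewrite muln_gt0 m0.
by split; rewrite /=; [rewrite exprM zm expr1n | rewrite mulnC exprM wk expr1n].
Qed.

End CommutingMatrix.
(** * Bidiagonal form *)

(** Sequences indexed by [nat] make it easy to juxtapose blocks. A 1 may join two distinct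
    eigenvalues, so the family is wider than that of Jordan forms. *)
Definition bidiag (F : nzRingType) m (l : nat -> F) (b : nat -> bool) : 'M[F]_m :=
  \matrix_(i, j) if i == j then l i else if j == i.+1 :> nat then (b i)%:R else 0.

Section BidiagonalForm.

Variable F : closedFieldType.

Definition chain m (A : 'M[F]_m) (a : F) (v : 'rV_m) k : 'M_(k, m) :=
  \matrix_(i, j) (v *m (A - a%:M) ^+ i) 0 j.

Lemma row_chain m (A : 'M[F]_m) a v k (i : 'I_k) : row i (chain A a v k) = v *m (A - a%:M) ^+ i.
Proof. by apply/rowP => j; rewrite !mxE. Qed.

Lemma chain_bidiag m (A : 'M[F]_m) a v k : v *m (A - a%:M) ^+ k = 0 ->
  chain A a v k *m A = bidiag k (fun=> a) (fun=> true) *m chain A a v k.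
Proof.
move=> vk; apply/row_matrixP => i; rewrite !row_mul row_chain.
rewrite [RHS]mulmx_sum_row (bigD1 i) //= !mxE eqxx row_chain.
have -> : v *m (A - a%:M) ^+ i *m A = a *: (v *m (A - a%:M) ^+ i) + v *m (A - a%:M) ^+ i.+1.
  rewrite exprSr -[_ * (A - _)]/(_ *m (A - _)) mulmxA mulmxBr mul_mx_scalar.
  by rewrite [RHS]addrC subrK.
congr (_ + _); have [lt|ge] := ltnP i.+1 k.
  have nlt : Ordinal lt != i by rewrite -val_eqE /= gtn_eqF.
  rewrite (bigD1 (Ordinal lt) nlt) /= !mxE eq_sym (negPf nlt) eqxx scale1r row_chain.
  rewrite big1 ?addr0 // => j /andP[ji jS]; rewrite !mxE eq_sym (negPf ji).
  by move: jS; rewrite -val_eqE /= => /negPf->; rewrite scale0r.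
have -> : i.+1 = k by apply/eqP; rewrite eqn_leq ge ltn_ord.
rewrite vk big1 // => j ji; rewrite !mxE eq_sym (negPf ji).
by case: eqP => [E|]; [have := ltn_ord j; rewrite E ltnNge ge | rewrite scale0r].
Qed.

(** A Hankel matrix: the entry depends on i + j only, and vanishes for i + j >= k once (A - a)^k
    kills [v] or [w]. *)
Lemma chain_pairing m (A : 'M[F]_m) a (v : 'rV_m) (w : 'cV_m) k (i j : 'I_k) :
  (chain A a v k *m (chain A^T a w^T k)^T) i j = (v *m (A - a%:M) ^+ (i + j) *m w) 0 0.
Proof.
have Xtr l : ((A^T - a%:M) ^+ l)^T = (A - a%:M) ^+ l.
  elim: l => [|l IH]; first by rewrite !expr0 trmx1.
  by rewrite exprS exprSr trmx_mul IH linearB /= trmxK tr_scalar_mx.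
have -> : (chain A a v k *m (chain A^T a w^T k)^T) i j =
   (row i (chain A a v k) *m (row j (chain A^T a w^T k))^T) 0 0.
  by rewrite !mxE; apply: eq_bigr => s _; rewrite !mxE.
by rewrite !row_chain trmx_mul trmxK Xtr exprD -[_ * _]/(_ *m _) !mulmxA.
Qed.

(** Reversing the columns gives a triangular matrix with nonzero diagonal. *)
Lemma antitriangular_free k (T : 'M[F]_k) :
  (forall i j : 'I_k, (k <= i + j)%N -> T i j = 0) ->
  (forall i j : 'I_k, (i + j).+1 = k -> T i j != 0) -> row_free T.
Proof.
move=> T0 T1; apply/inj_row_free => u uT; pose T' := colsub (@rev_ord k) T.
have T'u : T'^T \in unitmx.
  rewrite unitmxE det_trig.
    rewrite unitfE; apply/prodf_neq0 => i _; rewrite !mxE; apply: T1 => /=.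
    by have := ltn_ord i; lia.
  apply/is_trig_mxP => i j ij; rewrite !mxE; apply: T0 => /=.
  by have := ltn_ord i; have := ltn_ord j; lia.
have uT' : u *m T' = 0 by rewrite mulmx_colsub uT; apply/matrixP => i j; rewrite !mxE.
by rewrite unitmx_tr in T'u; apply: (can_inj (mulmxK T'u)); rewrite uT' mul0mx.
Qed.

(* With a minimal polynomial (X - a)^k q, the matrix (A - a)^(k-1) q(A)^2 is nonzero. *)
Lemma dual_chains p (A : 'M[F]_p.+1) a : eigenvalue A a ->
  exists k (v : 'rV_p.+1) (w : 'cV_p.+1), [/\ (0 < k)%N, v *m (A - a%:M) ^+ k = 0,
     (A - a%:M) ^+ k *m w = 0 & (v *m (A - a%:M) ^+ k.-1 *m w) 0 0 != 0].
Proof.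
rewrite eigenvalue_root_min => ra.
have [k [q]] := multiplicity_XsubC (mxminpoly A) a.
rewrite monic_neq0 ?mxminpoly_monic //= => nq Em.
have k0 : (0 < k)%N by rewrite lt0n; apply: contraNneq nq => k0; rewrite Em k0 expr0 mulr1 in ra.
have EN l : horner_mx A (('X - a%:P) ^+ l) = (A - a%:M) ^+ l.
  by rewrite rmorphXn rmorphB /= horner_mx_X horner_mx_C.
have z1 : horner_mx A q *m (A - a%:M) ^+ k = 0.
  by rewrite -EN -[_ *m _]/(_ * _) -rmorphM /= -Em mx_root_minpoly.
have z2 : (A - a%:M) ^+ k *m horner_mx A q = 0.
  by rewrite -EN -[_ *m _]/(_ * _) -rmorphM mulrC /= -Em mx_root_minpoly.
have M0 : horner_mx A (q * ('X - a%:P) ^+ k.-1 * q) != 0.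
  apply/eqP => /mxminpoly_min; rewrite Em -[in X in X %| _](prednK k0) exprSr mulrA.
  rewrite dvdp_mul2l; last first.
    rewrite mulf_neq0 ?expf_neq0 ?polyXsubC_eq0 //.
    by apply: contraNneq nq => ->; rewrite root0.
  by rewrite dvdp_XsubCl (negPf nq).
have [i [j Mij]] : exists i j, horner_mx A (q * ('X - a%:P) ^+ k.-1 * q) i j != 0.
  apply: contrapT => ne; case/eqP: M0; apply/matrixP => i j; rewrite mxE; apply/eqP.
  by apply: contraT => Mij; case: ne; exists i, j.
exists k, (delta_mx 0 i *m horner_mx A q), (horner_mx A q *m delta_mx j 0).
split=> //; first by rewrite -mulmxA z1 mulmx0.
  by rewrite mulmxA z2 mul0mx.
move: Mij; rewrite !rmorphM /= EN -![_ * _]/(_ *m _).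
set M := _ *m _ *m _; rewrite (_ : _ *m _ *m _ = delta_mx 0 i *m M *m delta_mx j 0).
  by rewrite -rowE -colE !mxE.
by rewrite /M !mulmxA.
Qed.

(* The span of a maximal chain of row vectors has as A-stable complement the
   annihilator of a dual chain of column vectors. *)
Lemma bidiagonalizable m (A : 'M[F]_m) : exists m' (V : 'M[F]_(m', m)) l b,
  [/\ row_free V, row_full V, V *m A = bidiag m' l b *m V &
      forall i, (i < m')%N -> eigenvalue A (l i)].
Proof.
have [N le] := ubnP m; elim: N m le A => // N IH [|p] le A.
  exists 0%N, 0, (fun=> 0), (fun=> true); split=> //.
  - by rewrite /row_free mxrank0.
  - by rewrite /row_full mxrank0.
  - by rewrite mul0mx mulmx0.
have [a Ea] : exists a, eigenvalue A a by apply: closed_eigenvalue.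
have [k [v [w [k0 vk kw vw]]]] := dual_chains Ea.
pose P := chain A a v k; pose Q := (chain A^T a w^T k)^T.
have wk : w^T *m (A^T - a%:M) ^+ k = 0.
  have -> : (A^T - a%:M) ^+ k = ((A - a%:M) ^+ k)^T.
    elim: (k) => [|l IHl]; first by rewrite !expr0 trmx1.
    by rewrite exprS exprSr IHl -[RHS]/(_ *m _)^T trmx_mul linearB /= tr_scalar_mx.
  by rewrite -trmx_mul kw trmx0.
have PA := chain_bidiag vk; have QA := chain_bidiag wk; rewrite -/P in PA.
have PQ : row_free (P *m Q).
  have vN l : (k <= l)%N -> v *m (A - a%:M) ^+ l = 0.
    by move=> kl; rewrite -(subnKC kl) exprD -[_ * _]/(_ *m _) mulmxA vk mul0mx.
  apply: antitriangular_free => i j ij; rewrite chain_pairing.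
    by rewrite vN // mul0mx mxE.
  by rewrite (_ : (i + j)%N = k.-1) //; apply: succn_inj; rewrite ij prednK.
have rQ : \rank Q = k.
  apply/eqP; rewrite eqn_leq rank_leq_col -{1}(eqP PQ); exact: mxrankM_maxr.
pose R := row_base (kermx Q).
have RQ : R *m Q = 0 by apply/sub_kermxP; rewrite eq_row_base.
have : stablemx (kermx Q) A.
  apply/sub_kermxP; rewrite -mulmxA.
  have -> : A *m Q = Q *m (bidiag k (fun=> a) (fun=> true))^T.
    by rewrite -trmx_mul -QA trmx_mul trmxK.
  by rewrite mulmxA mulmx_ker mul0mx.
rewrite -stablemx_row_base => /submxP[X RA]; rewrite -/R in X RA.
have Rfree : row_free R := row_base_free _.
clearbody R.
have rR : \rank (kermx Q) = (p.+1 - k)%N by rewrite mxrank_ker rQ.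
have [|m' [V [l [b [Vfree Vfull VX lX]]]]] := IH _ _ X.
  by rewrite rR; move: le k0; clear; lia.
pose l' i := if (i < k)%N then a else l (i - k)%N.
(* The entry at [k.-1] is 0: the chain ends there and is not linked to the complement. *)
pose b' i := if (i < k)%N then i != k.-1 else b (i - k)%N.
exists (k + m')%N, (col_mx P (V *m R)), l', b'.
have free : row_free (col_mx P (V *m R)).
  apply/inj_row_free => u; rewrite -[u]hsubmxK mul_row_col => E.
  have u1 : lsubmx u = 0.
    have := congr1 (mulmx^~ Q) E; rewrite /= mulmxDl -!mulmxA RQ !mulmx0 addr0 mul0mx => E1.
    by apply: (row_free_inj PQ); rewrite E1 mul0mx.
  move: E; rewrite u1 mul0mx add0r mulmxA => E.
  have VR : row_free (V *m R) by rewrite /row_free mxrankMfree.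
  by rewrite (_ : rsubmx u = 0) ?row_mx0 //; apply: (row_free_inj VR); rewrite mulmxA E mul0mx.
split=> //.
- rewrite /row_full (eqP free).
  have : m' = \rank (kermx Q) by rewrite -(eqP Vfree) (eqP Vfull).
  move=> ->; rewrite rR subnKC // -rQ; exact: rank_leq_row.
- rewrite mul_col_mx PA -mulmxA RA mulmxA VX.
  have -> : bidiag (k + m') l' b' = block_mx (bidiag k (fun=> a) (fun=> true)) 0 0 (bidiag m' l b).
    apply/matrixP => i j; rewrite -(splitK i) -(splitK j).
    case: (split i) => i'; case: (split j) => j' /=.
    - rewrite block_mxEul !mxE -!val_eqE /= /l' /b' ltn_ord; case: eqP => // _.
      by case: eqP => // E; rewrite neq_ltn -ltnS prednK // -E ltn_ord.
    - rewrite block_mxEur !mxE -!val_eqE /= /b' ltn_ord; have lt := ltn_ord i'.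
      case: eqP => [E|_]; first by move: lt; rewrite E ltnNge leq_addr.
      case: eqP => // E; suff /eqP -> : i' = k.-1 :> nat by [].
      by move: E lt; clear; lia.
    - rewrite block_mxEdl !mxE -!val_eqE /=; have lt := ltn_ord j'.
      case: eqP => [E|_]; first by move: lt; rewrite -E ltnNge leq_addr.
      by case: eqP => // E; move: lt; rewrite E ltnNge leqW ?leq_addr.
    - rewrite block_mxEdr !mxE -!val_eqE /= eqn_add2l -addnS eqn_add2l /l' /b'.
      by rewrite ltnNge leq_addr addKn.
  by rewrite mul_block_col !mul0mx addr0 add0r mulmxA.
- move=> i im; rewrite /l'; case: ltnP => ik //.
  have /lX/eigenvalueP[u uX u0] : (i - k < m')%N by rewrite ltn_subLR.
  apply/eigenvalueP; exists (u *m R); last by rewrite mulmx_free_eq0.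
  by rewrite -mulmxA RA mulmxA uX scalemxAl.
Qed.

End BidiagonalForm.
Lemma bidiag_representatives (F : closedFieldType) n (X : seq F) :
  exists reps : seq 'M[F]_n.+1, size reps = (size X ^ n.+1 * 2 ^ n)%N /\
    forall A : 'M[F]_n.+1, (forall x, eigenvalue A x -> x \in X) ->
    exists2 B, B \in reps & mx_conjugate A B.
Proof.
pose rep (p : {ffun 'I_n.+1 -> 'I_(size X)} * {ffun 'I_n -> bool}) : 'M[F]_n.+1 :=
  bidiag n.+1 (fun i => nth 0 X (p.1 (inord i))) (fun i => oapp p.2 false (insub i)).
exists (map rep (enum [set: {ffun 'I_n.+1 -> 'I_(size X)} * {ffun 'I_n -> bool}])).
split; first by rewrite size_map -cardE cardsT card_prod !card_ffun !card_ord card_bool.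
move=> A AX; have [m [V [l [b [Vfree Vfull VA lA]]]]] := bidiagonalizable A.
have Em : m = n.+1 by rewrite -(eqP Vfree) (eqP Vfull).
rewrite {m}Em in V Vfree Vfull VA lA.
have lX i : (i < n.+1)%N -> (index (l i) X < size X)%N by move=> /lA/AX; rewrite index_mem.
pose p1 := [ffun i : 'I_n.+1 => Ordinal (lX i (ltn_ord i))].
pose p2 := [ffun i : 'I_n => b i].
exists (rep (p1, p2)); first by apply: map_f; rewrite mem_enum inE.
have -> : rep (p1, p2) = bidiag n.+1 l b.
  apply/matrixP => i j; rewrite !mxE inord_val /= ffunE /= nth_index; last first.
    by rewrite -index_mem lX.
  case: eqP => // _; case: eqP => // E.
  have lt : (i < n)%N by rewrite -ltnS -E.
  by rewrite insubT /= ffunE.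
have Vu : V \in unitmx by rewrite -row_free_unit.
exists (invmx V); split; first by rewrite unitmx_inv.
by rewrite invmxK -[RHS]/(_ *m _ *m _) -mulmxA -VA mulKmx.
Qed.

(** * Comparison with the stated bound *)

(** With r = n + 1 and y = 4 r^4 df dg one has 2 N <= 36 y, while df + dg >= 2 makes the base of the
    power in [thm_bound] at least 11 r y. After multiplication by 2 it remains to see that 36^r <= 4
    (11 r)^r. *)
Lemma class_count_bound n N df dg : (0 < df)%N -> (0 < dg)%N ->
  (N <= 72 * n.+1 ^ 4 * (df * dg) -> N ^ n.+1 * 2 ^ n <= thm_bound n.+1 df dg)%N.
Proof.
move=> df0 dg0 leN; set y := (4 * (n.+1 ^ 4 * (df * dg)))%N.
have le1 : (2 * N <= 36 * y)%N by move: leN; rewrite /y -!mulnA; lia.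
have le2 : (11 * n.+1 * y <= 22 * n.+1 ^ 5 * (df + dg) * (df * dg))%N.
  have s2 : (2 <= df + dg)%N by lia.
  rewrite (_ : 11 * n.+1 * y = 22 * n.+1 ^ 5 * 2 * (df * dg))%N; last by rewrite /y (expnS _ 4); ring.
  by rewrite leq_mul2r leq_mul2l s2 !orbT.
rewrite /thm_bound -(leq_pmul2l (isT : 0 < 2)%N).
rewrite (_ : 2 * (N ^ n.+1 * 2 ^ n) = (2 * N) ^ n.+1)%N; last first.
  by rewrite expnMn (expnS 2) mulnCA mulnC -mulnA (mulnC _ (N ^ _)%N).
apply: leq_trans (_ : (36 * y) ^ n.+1 <= _)%N; first by rewrite leq_exp2r.
apply: leq_trans (_ : 4 * (11 * n.+1 * y) ^ n.+1 <= _)%N; last first.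
  by rewrite mulnA leq_mul2l leq_exp2r // le2 orbT.
rewrite !(expnMn _ y) mulnA leq_mul2r; apply/orP; right.
(* The cases r = 1, 2, 3 are numerical; from r = 4 on, 36 <= 11 r. *)
case: n {leN le1 le2 y} => [|[|[|n]]]; try by rewrite !expnS expn0; lia.
apply: leq_trans (_ : (11 * n.+4) ^ n.+4 <= _)%N; last by rewrite leq_pmull.
by rewrite leq_exp2r //; lia.
Qed.

(* r = n.+1 >= 1; matrices over C = R[i]. *)
Theorem theorem1p4 (R : realType) (n : nat) (f g : {poly 'M[R[i]]_n.+1}) :
  (1 < size f)%N -> (1 < size g)%N ->
  eigen_mult_indep f g ->
  exists reps : seq 'M[R[i]]_n.+1,
    (size reps <= thm_bound n.+1 (mxdeg f) (mxdeg g))%N /\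
    forall A : 'M[R[i]]_n.+1,
      (forall i : nat, GRing.comm A f`_i) ->
      (forall i : nat, GRing.comm A g`_i) ->
      torsion_mx (mxpoly_eval f A) ->
      torsion_mx (mxpoly_eval g A) ->
      exists2 B, B \in reps & mx_conjugate A B.
Proof.
move=> sf sg [K [phi [phi_inj indep]]].
have df0 : (0 < mxdeg f)%N by rewrite -ltnS prednK // ltnW.
have dg0 : (0 < mxdeg g)%N by rewrite -ltnS prednK // ltnW.
have [X sX XP] := few_special phi_inj df0 dg0 (ltn0Sn n) (mxsize_mxpoly_xI sf)
  (mxsize_mxpoly_xI sg) indep.
have [reps [sreps repsP]] := bidiag_representatives n X.
exists reps; split; first by rewrite sreps class_count_bound.
move=> A Af Ag tf tg; apply: repsP => x Ax.
have [u su] := eigenvalue_special Af Ag tf tg Ax.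
exact: XP su.
Qed.
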